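(* If $G$ is a $2$-vertex-connected plane graph, then $\chi_{\mathrm{fum}}'(G) \leq 4$.
   Context: All graphs are simple. A plane graph is a graph embedded in the plane without crossing edges. Two distinct edges of an embedded graph are facially adjacent if they are consecutive in some facial path, i.e., they have a common vertex and they are incident with a same face (consecutively along its boundary). A facial edge-coloring is a coloring of the edges such that facially adjacent edges receive distinct colors. A FUM-edge-coloring is a facial edge-coloring with integers such that, for each face (including the outer face), the maximal color appearing on the edges incident with that face appears on exactly one edge incident with that face. $\chi_{\mathrm{fum}}'(G)$ denotes the minimum $k$ such that $G$ admits a FUM-edge-coloring using colors from $\{1,\ldots,k\}$. *)

(* Defs.v *)
From mathcomp Require Import all_boot.
Set Implicit Arguments.
Unset Strict Implicit.
Unset Printing Implicit Defensive.

Record sgraph (V : finType) := SGraph {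
  adj :> rel V;
  adj_sym : symmetric adj;
  adj_irr : irreflexive adj }.

Section SimpleGraph.
Variables (V : finType) (G : sgraph V).

Definition edges : {set {set V}} :=
  [set e | [exists x, [exists y, G x y && (e == [set x; y])]]].

Definition connected_avoiding (X : {set V}) : Prop :=
  forall x y, x \notin X -> y \notin X ->
    connect [rel a b | [&& G a b, a \notin X & b \notin X]] x y.

Definition vertex_connected (k : nat) : Prop :=
  k < #|V| /\ forall X : {set V}, #|X| < k -> connected_avoiding X.

(* A dart is an edge with a direction, from d.1 to d.2. *)
Definition darts : {set V * V} := [set d | G d.1 d.2].

(* The cyclic order in which an embedding into an oriented surface arranges
   the edges around each vertex: [rot_next v w] is the neighbour of v that follows
   w around v. Values of [rot_next v] outside the neighbourhood of v are junk. *)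
Record rotation := Rotation {
  rot_next :> V -> V -> V;
  rot_next_adj : forall v w, G v w -> G v (rot_next v w);
  rot_next_cyclic : forall v w w', G v w -> G v w' ->
    fconnect (rot_next v) w w' }.

End SimpleGraph.

Section Embedding.
Variables (V : finType) (G : sgraph V) (N : rotation G).

Definition edge_of (d : V * V) : {set V} := [set d.1; d.2].

(* One step along a facial walk: enter d.2 along d, and leave it along the
   edge that follows d in the rotation at d.2. *)
Definition face_step (d : V * V) : V * V := (d.2, N d.2 d.1).

(* A face is represented by the darts of its closed boundary walk. *)
Definition face_at (d : V * V) : {set V * V} :=
  [set d' | fconnect face_step d d'].

Definition faces : {set {set V * V}} := [set face_at d | d in darts G].

(* For a connected graph with at least one edge, the surface obtained by gluing
   a disc along each facial walk is a sphere exactly when Euler's formula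
   holds. No face is distinguished as the outer one. *)
Definition plane : Prop := #|V| + #|faces| = #|edges G| + 2.

Definition boundary (F : {set V * V}) : {set {set V}} :=
  [set edge_of d | d in F].

Definition facially_adjacent (e f : {set V}) : bool :=
  (e != f) &&
  [exists d in darts G,
     ((e == edge_of d) && (f == edge_of (face_step d))) ||
     ((f == edge_of d) && (e == edge_of (face_step d)))].

Section Coloring.
Variable c : {set V} -> nat.

Definition facial_edge_coloring : bool :=
  [forall e in edges G, forall f in edges G,
     facially_adjacent e f ==> (c e != c f)].

Definition unique_maximum : bool :=
  [forall F in faces,
     #|[set e in boundary F | c e == \max_(f in boundary F) c f]| == 1].

Definition fum_edge_coloring : bool := facial_edge_coloring && unique_maximum.

End Coloring.

(* The bounded codomain only serves to make the quantifier finite; the values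
   of c outside the edge set are irrelevant. *)
Definition fum_edge_colorable (k : nat) : bool :=
  [exists c : {ffun {set V} -> 'I_k.+1},
     [forall e in edges G, 1 <= c e <= k] &&
     fum_edge_coloring (fun e => c e)].

Lemma fum_edge_colorable_ex : exists k, fum_edge_colorable k.
Proof.
exists #|{set V}|; apply/existsP.
pose c : {ffun {set V} -> 'I_#|{set V}|.+1} :=
  [ffun e => lift ord0 (enum_rank e)].
have cE e : c e = (enum_rank e).+1 :> nat by rewrite ffunE.
have c_inj e f : c e = c f :> nat -> e = f.
  by rewrite !cE => -[/val_inj/enum_rank_inj].
exists c; apply/and3P; split.
- by apply/forall_inP => e _; rewrite cE /= ltn_ord.
- apply/forall_inP => e _; apply/forall_inP => f _; apply/implyP => /andP[ne _].
  by apply: contra ne => /eqP/c_inj->.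
apply/forall_inP => _ /imsetP[d _ ->].
have dB : edge_of d \in boundary (face_at d).
  by apply: imset_f; rewrite inE connect0.
have [m mB mE] : {m | m \in boundary (face_at d) &
    \max_(f in boundary (face_at d)) c f = c m :> nat}.
  by apply: eq_bigmax_cond; apply/card_gt0P; exists (edge_of d).
rewrite mE; apply/cards1P; exists m; apply/setP => e; rewrite !inE.
apply/andP/eqP => [[_ /eqP/c_inj //]|->]; by rewrite eqxx.
Qed.

Definition chi_fum' : nat := ex_minn fum_edge_colorable_ex.

End Embedding.

(* Main.v *)
Require Import Defs.
From mathcomp Require Import all_boot all_algebra.

Set Implicit Arguments.
Unset Strict Implicit.
Unset Printing Implicit Defensive.

(** Colour 4 is spent on a set of edges no two of which lie on a common face;
   a face with such an edge is settled, and its other edges only have to get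
   colours 1, 2, 3 subject to facial adjacency. A face without colour 4 gets a
   single 3 and is otherwise coloured 1, 2 alternately. An edge whose two faces
   are settled can always be coloured from 1, 2, 3 if at most two of its facial
   neighbours were coloured before it. So everything rests on an order of
   colouring, which is built backwards, by peeling edges off a set [S] of
   edges not yet peeled ([S] is the whole edge set at first). A face is
   intact if all its edges are in [S]. There are three ways to peel:

   - [drop_top]: an edge between two intact faces; it gets colour 4, and settles
     both faces;
   - [drop_edge]: an edge between two broken faces that has at most two facial
     neighbours in [S];
   - [drop_face]: the whole boundary of an intact face all of whose neighbouring
     faces are broken and which touches the rest of [S] at one vertex only.

   It remains to see that peeling never gets stuck ([peel]). The invariant is
   [glued]: the broken faces form one region when glued along the peeled
   edges. By planarity a cycle of [S] then has only intact faces on one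
   side, so that two edges of [S] at a vertex [y] that are joined in [S]
   without using [y] have only intact corners between them, on one side or the
   other ([arc_of_cycle]). Take an end block of the graph formed by [S],
   attached to the rest at [y] ([end_block]), with at least two edges of [S] at
   each vertex (else [peel_leaf]). As [y] is no cut vertex of the whole graph,
   some vertex of the block other than [y] carries a peeled edge. The two
   extreme edges of the block at that vertex lie between an intact and a broken
   face and have a peeled neighbour; as there are no parallel edges, one of them
   avoids [y]. If the intact face [F] next to that edge has an intact
   neighbour across an edge [m], dropping a suitable such [m] with colour 4
   leaves the edge at most two neighbours ([openable_next],
   [openable_prev]), and peeling it as well merges the newly broken faces into
   the region ([peel_pair]). Otherwise the block is just the boundary of [F], and
   [drop_face] applies ([peel_face]).

   Planarity enters through [cycle_bounds]: modulo 2, cycles are boundaries of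
   sets of faces, by a dimension count from Euler's formula. *)

(** * Darts, rotations and facial walks *)

Section Walks.
Variables (V : finType) (G : sgraph V) (N : rotation G).
Implicit Types (u v w : V) (d : V * V) (S : {set {set V}}).
Local Notation step := (face_step N).

Definition flip d : V * V := (d.2, d.1).

Lemma dartE u v : ((u, v) \in darts G) = G u v.
Proof. by rewrite inE. Qed.

Lemma flipK d : flip (flip d) = d.
Proof. by case: d. Qed.

Lemma dart_flip d : (flip d \in darts G) = (d \in darts G).
Proof. by rewrite !inE /= adj_sym. Qed.

Lemma edge_flip d : edge_of (flip d) = edge_of d.
Proof. by rewrite /edge_of /= setUC. Qed.

Lemma edgeC u v : edge_of (u, v) = edge_of (v, u).
Proof. exact: (edge_flip (v, u)). Qed.

Lemma adj_neq u v : G u v -> u != v.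
Proof. by move=> Guv; apply: contraTneq Guv => ->; rewrite adj_irr. Qed.

Lemma flip_neq d : d \in darts G -> flip d != d.
Proof.
case: d => u v; rewrite dartE => /adj_neq uv.
by apply: contra uv => /eqP[->].
Qed.

Lemma mem_edges d : d \in darts G -> edge_of d \in edges G.
Proof.
case: d => u v; rewrite dartE => Guv; rewrite inE.
by apply/existsP; exists u; apply/existsP; exists v; rewrite Guv /=.
Qed.

Lemma edgesP e :
  reflect (exists2 d, d \in darts G & e = edge_of d) (e \in edges G).
Proof.
apply: (iffP idP) => [|[d dG ->]]; last exact: mem_edges.
rewrite inE => /existsP[u /existsP[v /andP[Guv /eqP->]]].
by exists (u, v); rewrite ?dartE.
Qed.

Lemma edge_of_eq d d' :
  edge_of d = edge_of d' -> d = d' \/ d = flip d'.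
Proof.
case: d d' => [u v] [a b]; rewrite /edge_of /flip /= => E.
have: u \in [set a; b] by rewrite -E set21.
have: v \in [set a; b] by rewrite -E set22.
have: a \in [set u; v] by rewrite E set21.
have: b \in [set u; v] by rewrite E set22.
rewrite !inE.
by do 4![case/orP=> /eqP ?]; subst; by [left | right].
Qed.

Lemma rot_nbr v : {homo N v : w / w \in G v}.
Proof. move=> w; exact: rot_next_adj. Qed.

(** A map that is cyclic on a finite set is onto, hence injective. *)
Lemma rot_inj v : {in G v &, injective (N v)}.
Proof.
pose A := [set w | G v w].
have AE : N v @: A = A.
  apply/eqP; rewrite eqEsubset; apply/andP; split; apply/subsetP => w.
    by case/imsetP=> a; rewrite !inE => ? ->; apply: rot_next_adj.
  rewrite inE => Gvw.
  have := iter_findex (rot_next_cyclic N (rot_next_adj N Gvw) Gvw).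
  rewrite -iterSr iterS => <-; apply: imset_f; rewrite inE.
  by apply: (iter_in (S := G v)) => //; apply: rot_nbr.
have /imset_injP inj : #|N v @: A| == #|A| by rewrite AE.
by move=> a b aG bG; apply: inj; rewrite inE.
Qed.

(** [N v] need not be injective off the neighbourhood of [v], so only its
   restriction to the neighbours is inverted. *)
Definition rot_prev v w := finv (N v) w.

Lemma rot_prev_adj v w : G v w -> G v (rot_prev v w).
Proof. exact: (finv_in (@rot_nbr v)). Qed.

Lemma rot_prevK v w : G v w -> N v (rot_prev v w) = w.
Proof. exact: (f_finv_in (@rot_nbr v) (@rot_inj v)). Qed.

Lemma rot_nextK v w : G v w -> rot_prev v (N v w) = w.
Proof. exact: (finv_f_in (@rot_nbr v) (@rot_inj v)). Qed.

Lemma step_dart : {homo step : d / d \in darts G}.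
Proof. by case=> u v; rewrite !dartE adj_sym => /(rot_next_adj N). Qed.

Lemma step_inj : {in darts G &, injective step}.
Proof.
move=> [u v] [a b]; rewrite !dartE => Guv Gab [vb]; subst b => E.
by congr pair; move: E; apply: rot_inj; rewrite -topredE /= adj_sym.
Qed.

Lemma face_at_refl d : d \in face_at N d.
Proof. by rewrite inE connect0. Qed.

Lemma face_at_dart d d' :
  d \in darts G -> d' \in face_at N d -> d' \in darts G.
Proof.
move=> dG; rewrite inE => /iter_findex <-.
by apply: (iter_in (S := mem (darts G))) => //; apply: step_dart.
Qed.

Lemma face_at_eq d d' :
  d \in darts G -> d' \in face_at N d -> face_at N d' = face_at N d.
Proof.
move=> dG d'd; have d'G := face_at_dart dG d'd.
move: d'd; rewrite inE => d'd.
have dd' : fconnect step d' d.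
  by rewrite (fconnect_sym_in step_dart step_inj).
apply/setP => x; rewrite !inE; apply/idP/idP; exact: connect_trans.
Qed.

Lemma face_at_sym d d' :
  d \in darts G -> d' \in face_at N d -> d \in face_at N d'.
Proof. by move=> dG d'd; rewrite (face_at_eq dG d'd) face_at_refl. Qed.

Lemma mem_step d : step d \in face_at N d.
Proof. by rewrite inE fconnect1. Qed.

Lemma face_step_mem d d' :
  d \in darts G -> d' \in face_at N d -> step d' \in face_at N d.
Proof.
move=> dG d'd; rewrite -(face_at_eq dG d'd); exact: mem_step.
Qed.

Lemma imset_step d : d \in darts G -> step @: face_at N d = face_at N d.
Proof.
move=> dG; apply/eqP; rewrite eqEcard; apply/andP; split.
  by apply/subsetP => _ /imsetP[a aF ->]; apply: face_step_mem.
rewrite card_in_imset // => a b aF bF.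
by apply: step_inj; apply: (face_at_dart dG).
Qed.

Lemma face_pred d d' : d \in darts G -> d' \in face_at N d ->
  exists2 d0, d0 \in face_at N d & step d0 = d'.
Proof.
move=> dG; rewrite -{1}(imset_step dG) => /imsetP[d0 d0F ->].
by exists d0.
Qed.

Lemma facesP F :
  reflect (exists2 d, d \in darts G & F = face_at N d) (F \in faces N).
Proof. exact: imsetP. Qed.

(** Entering [v] along one edge, stepping and reversing turns from that edge to
   the next one around [v], so that steps and reversals together reach every
   dart of a connected graph. *)
Lemma dart_invariant (T : eqType) (x : V * V -> T) :
  (forall u v, connect G u v) ->
  (forall d, d \in darts G -> x (step d) = x d) ->
  (forall d, d \in darts G -> x (flip d) = x d) ->
  {in darts G &, forall d d', x d = x d'}.
Proof.
move=> conn xs xf.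
have around v w : G v w -> forall w', G v w' -> x (v, w) = x (v, w').
  move=> Gw w' Gw'.
  have /iter_findex <- := rot_next_cyclic N Gw Gw'.
  elim: findex => // n ->; set a := iter n _ w.
  have Ga : G v a by apply: (iter_in (S := G v)) => //; apply: rot_nbr.
  have aG : (a, v) \in darts G by rewrite dartE adj_sym.
  by rewrite -(xf (v, a)) ?dartE // -(xs (a, v)).
have reach u v : connect G u v -> forall a b, G u a -> G v b -> x (u, a) = x (v, b).
  case/connectP => p; elim: p u => [|w p IH] u /=.
    by move=> _ -> a b Ga Gb; apply: around.
  case/andP=> Guw pth lst a b Ga Gb.
  rewrite (around _ _ Ga w) // -(IH w pth lst u) ?[G w u]adj_sym //.
  by rewrite -(xf (u, w)) // dartE.
by case=> u v [a b]; rewrite !dartE => ? ?; apply: reach.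
Qed.

End Walks.

(** * End blocks *)

Definition avoid (T : eqType) (r : rel T) (y : T) :=
  [rel p q | [&& r p q, p != y & q != y]].

Section EndBlock.
Variables (T : finType) (r : rel T).
Hypotheses (r_sym : symmetric r) (r_irr : irreflexive r).

Lemma avoid_sym y : symmetric (avoid r y).
Proof. by move=> p q /=; rewrite r_sym [(p != y) && _]andbC. Qed.

Lemma connect_avoid y a b : a != y -> connect (avoid r y) a b -> b != y.
Proof.
move=> ay /connectP[p]; elim: p a ay => [|c p IH] a ay /=; first by move=> _ ->.
by case/andP=> /and3P[_ _ cy]; apply: IH.
Qed.

(** Among all pieces that arise by deleting a vertex [y] and keeping what is
   reachable from a neighbour of [y], a smallest one contains no cut vertex: if
   [v] in it separated two of its neighbours, one of them would be cut off from
   [y], and would span a smaller piece. *)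
Lemma end_block a0 b0 : r a0 b0 -> exists y (D : {set T}),
  [/\ exists a, a \in D, y \notin D,
      forall v, v \in D -> exists w, r v w,
      forall v w, v \in D -> r v w -> w \in D \/ w = y &
      forall v b b', v \in D -> r v b -> r v b' -> connect (avoid r v) b b'].
Proof.
move=> r0; pose part (t : T * T) := [set w | connect (avoid r t.1) t.2 w].
case: (@arg_minnP _ (a0, b0) (fun t => r t.1 t.2) (fun t => #|part t|) r0).
case=> y a /= rya minD; set D := part (y, a) in minD.
have ne u w : r u w -> u != w.
  by move=> ruw; apply: contraTneq ruw => ->; rewrite r_irr.
have ay : a != y by rewrite eq_sym ne.
have yD : y \notin D.
  by rewrite inE; apply/negP => /(connect_avoid ay); rewrite eqxx.
have closed v w : v \in D -> r v w -> w \in D \/ w = y.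
  move=> vD rvw; case: (eqVneq w y) => [|wy]; [by right | left].
  have vy : v != y by apply: contraNneq yD => <-.
  move: vD; rewrite !inE => /connect_trans; apply.
  by apply: connect1; rewrite /= rvw vy.
exists y, D; split=> //; first by exists a; rewrite inE connect0.
  move=> v; rewrite inE => /connectP[p]; case/lastP: p => [|p x].
    by move=> _ ->; exists y; rewrite r_sym.
  rewrite rcons_path last_rcons => /andP[_ /and3P[rx _ _]] ->.
  by exists (last a p); rewrite r_sym.
move=> v b b' vD rvb rvb'; apply: contraT => nbb'.
have csym := sym_connect_sym (avoid_sym v).
have [c rvc ncy] : exists2 c, r v c & ~~ connect (avoid r v) c y.
  case: (boolP (connect (avoid r v) b y)) => by_; last by exists b.
  exists b' => //; apply: contra nbb' => b'y.
  by apply: connect_trans by_ _; rewrite csym.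
have cD : c \in D.
  by case: (closed _ _ vD rvc) => // cy; rewrite cy connect0 in ncy.
have sub : part (v, c) \subset D.
  apply/subsetP => w; rewrite [w \in part _]inE => /connectP[p + ->] {w}.
  elim/last_ind: p => [|p x IH] //.
  rewrite rcons_path last_rcons => /andP[pth /and3P[rx nv nx]].
  case: (closed _ _ (IH pth) rx) => // xy; case/negP: ncy; rewrite -xy.
  apply/connectP; exists (rcons p x); last by rewrite last_rcons.
  by rewrite rcons_path pth /= rx nv nx.
have vc : v \notin part (v, c).
  rewrite inE; apply/negP => /connect_avoid; rewrite eqxx eq_sym.
  by move/(_ (ne _ _ rvc)).
have /proper_card : part (v, c) \proper D.
  by apply/properP; split=> //; exists v.
by rewrite ltnNge minD.
Qed.

End EndBlock.

(** * Cycles bound, modulo 2 *)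

Section Homology.
Import GRing.Theory.
Local Open Scope ring_scope.

Lemma addFF (x : 'F_2) : x + x = 0.
Proof. by apply: addrr_pchar2; apply: pchar_Fp. Qed.

Lemma addF_eq0 (x y : 'F_2) : x + y = 0 -> x = y.
Proof. by move=> xy0; apply/eqP; rewrite -subr_eq0 -xy0 -[- y]addr0 -(addFF y) addKr. Qed.

Lemma sum_delta (T : finType) (A : {set T}) (a : T) (g : T -> 'F_2) :
  \sum_(e in A) (a == e)%:R * g e = (a \in A)%:R * g a.
Proof.
rewrite (eq_bigr (fun e => if e == a then g a else 0)) => [|e _].
  rewrite -big_mkcondr /=; case: (boolP (a \in A)) => aA.
    rewrite (eq_bigl (pred1 a)) ?big_pred1_eq ?mul1r // => e /=.
    by case: eqP => [->|]; rewrite ?aA ?andbF.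
  rewrite mul0r big1 // => e /andP[eA /eqP ea].
  by rewrite -ea eA in aA.
by rewrite eq_sym; case: eqP => [->|]; rewrite ?mul1r ?mul0r.
Qed.

Lemma sum_mem (T : finType) (A : {set T}) (a : T) :
  \sum_(e in A) (a == e)%:R = (a \in A)%:R :> 'F_2.
Proof.
rewrite -[RHS]mulr1 -(sum_delta A a (fun=> 1)).
by apply: eq_bigr => e _; rewrite mulr1.
Qed.

Lemma mem_edge_of (V : finType) (d : V * V) v : d.1 != d.2 ->
  (v \in edge_of d)%:R = (d.1 == v)%:R + (d.2 == v)%:R :> 'F_2.
Proof.
move=> nd; rewrite !inE ![v == _]eq_sym.
case: eqP => [<-|_] /=; last by rewrite add0r.
by rewrite eq_sym (negPf nd) addr0.
Qed.

(** A left kernel made of constant vectors has dimension at most one. *)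
Lemma mxrank_ker_const (m n : nat) (A : 'M['F_2]_(m, n)) :
  (forall x : 'rV_m, x *m A = 0 -> forall i j, x 0 i = x 0 j) ->
  (m <= (\rank A).+1)%N.
Proof.
move=> H; have: (kermx A <= (const_mx 1 : 'rV['F_2]_m))%MS.
  apply/row_subP => i; set x := row i _.
  have /H xc : x *m A = 0.
    by apply/sub_kermxP; apply: row_sub.
  case: m A H i x xc => [|m] A H i x xc; first by case: i.
  have -> : x = x 0 0 *: const_mx 1.
    by apply/rowP => j; rewrite [RHS]mxE [X in _ * X]mxE mulr1; apply: xc.
  exact: scalemx_sub.
move/mxrankS => /(leq_trans)/(_ (rank_leq_row _)).
by rewrite mxrank_ker leq_subLR addn1.
Qed.

Variables (V : finType) (G : sgraph V) (N : rotation G).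
Local Notation step := (face_step N).
Hypothesis hplane : plane N.
Hypothesis conn : forall u v, connect G u v.

(** An edge met twice by one facial walk counts zero, as it should modulo 2. *)
Definition bdry : 'M['F_2]_(#|faces N|, #|edges G|) :=
  \matrix_(i, j) \sum_(d in (enum_val i : {set V * V}))
     (edge_of d == enum_val j)%:R.

Definition incid : 'M['F_2]_(#|edges G|, #|V|) :=
  \matrix_(j, k) (enum_val k \in (enum_val j : {set V}))%:R.

Lemma face_darts F d : F \in faces N -> d \in F -> d \in darts G.
Proof. by case/facesP => d0 d0G ->; apply: face_at_dart. Qed.

Lemma dart_neq (d : V * V) : d \in darts G -> d.1 != d.2.
Proof. by rewrite inE; apply: adj_neq. Qed.

(** A facial walk enters a vertex as often as it leaves it. *)
Lemma bdry_incid : bdry *m incid = 0.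
Proof.
apply/matrixP => i k; rewrite !mxE; set v := enum_val k.
set F := enum_val i; have FG : F \in faces N by apply: enum_valP.
rewrite (eq_bigr (fun j => \sum_(d in F)
   (edge_of d == enum_val j)%:R * (v \in (enum_val j : {set V}))%:R)) => [|j _]; last first.
  by rewrite !mxE mulr_suml.
rewrite exchange_big /=.
have -> : \sum_(d in F) \sum_(j < #|edges G|)
    (edge_of d == enum_val j)%:R * (v \in (enum_val j : {set V}))%:R =
   \sum_(d in F) ((d.1 == v)%:R + (d.2 == v)%:R) :> 'F_2.
  apply: eq_bigr => d dF; have dG := face_darts FG dF.
  rewrite -(big_enum_val (fun e : {set V} => (edge_of d == e)%:R * (v \in e)%:R)) /=.
  by rewrite sum_delta mem_edges // mul1r mem_edge_of // dart_neq.
rewrite big_split /=.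
case/facesP: (FG) => d0 d0G FE.
rewrite [X in X + _](_ : _ = \sum_(d in F) (d.2 == v)%:R) ?addFF //.
rewrite FE -{1}(imset_step N d0G) big_imset //= => a b aF bF.
by apply: step_inj; [apply: face_at_dart aF | apply: face_at_dart bF].
Qed.

(** A coefficient vector on the faces, read as a function of darts that is
   constant along facial walks. *)
Definition face_fun (x : 'rV['F_2]_(#|faces N|)) (d : V * V) : 'F_2 :=
  \sum_i x 0 i * (d \in (enum_val i : {set V * V}))%:R.

Lemma face_fun_step x d : d \in darts G -> face_fun x (step d) = face_fun x d.
Proof.
move=> dG; apply: eq_bigr => i _; congr (_ * _%:R).
have /facesP[d0 d0G ->] := enum_valP i; congr (nat_of_bool _).
apply/idP/idP => dF; last exact: face_step_mem.
have := face_at_sym dG (mem_step N d); rewrite (face_at_eq d0G dF).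
by [].
Qed.

Lemma face_funE x i d : d \in (enum_val i : {set V * V}) -> face_fun x d = x 0 i.
Proof.
move=> dF; rewrite /face_fun (bigD1 i) //= dF mulr1 big1 ?addr0 // => j ji.
case: (boolP (d \in _)) => dFj; last by rewrite mulr0.
case/negP: ji; apply/eqP/enum_val_inj.
have /facesP[d0 d0G E] := enum_valP i.
have /facesP[d1 d1G E1] := enum_valP j.
rewrite E E1 in dF dFj *.
by rewrite -(face_at_eq d0G dF) -(face_at_eq d1G dFj).
Qed.

Lemma bdryE x d : d \in darts G -> forall j, enum_val j = edge_of d ->
  (x *m bdry) 0 j = face_fun x d + face_fun x (flip d).
Proof.
move=> dG j jE; rewrite mxE -big_split /=; apply: eq_bigr => i _.
rewrite mxE jE -mulrDr; congr (_ * _).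
rewrite -!sum_mem -big_split /=; apply: eq_bigr => d' _.
case: eqP => [/edge_of_eq[]->|ne].
- by rewrite eqxx (negPf (flip_neq dG)) addr0.
- by rewrite eqxx eq_sym (negPf (flip_neq dG)) add0r.
case: eqP => [E|_]; first by case: ne; rewrite E.
case: eqP => [E|_]; first by case: ne; rewrite -E edge_flip.
by rewrite addr0.
Qed.

Lemma rank_bdry : (#|faces N| <= (\rank bdry).+1)%N.
Proof.
apply: mxrank_ker_const => x x0 i j.
have /facesP[d dG di] := enum_valP i.
have /facesP[d' d'G d'j] := enum_valP j.
rewrite -(@face_funE x i d) ?di ?face_at_refl //.
rewrite -(@face_funE x j d') ?d'j ?face_at_refl //.
apply: (dart_invariant (N := N) conn) => // {di dG}d dG; first exact: face_fun_step.
apply/esym/addF_eq0; have eG := mem_edges dG.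
rewrite -(bdryE x dG (enum_rankK_in eG eG)).
by rewrite x0 mxE.
Qed.

Lemma rank_incid : (#|V| <= (\rank incid).+1)%N.
Proof.
rewrite -mxrank_tr; apply: mxrank_ker_const => x x0 i j.
pose y v := x 0 (enum_rank v).
suff yc u v : connect G u v -> y u = y v.
  by have := yc _ _ (conn (enum_val i) (enum_val j)); rewrite /y !enum_valK.
case/connectP => p; elim: p u => [|w p IH] u /=; first by move=> _ ->.
case/andP=> Guw pth lst; rewrite -(IH w pth lst).
have dG : (u, w) \in darts G by rewrite dartE.
have uw : u \notin [set w] by rewrite inE (adj_neq Guw).
have eG := mem_edges dG.
have /matrixP/(_ 0 (enum_rank_in eG (edge_of (u, w)))) := x0.
rewrite !mxE => E; apply: addF_eq0; rewrite -[RHS]E.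
rewrite (eq_bigr (fun k => \sum_(v in [set u; w]) x 0 k * (v == enum_val k)%:R)); last first.
  move=> k _; rewrite !mxE enum_rankK_in // -mulr_sumr; congr (_ * _).
  by rewrite big_setU1 //= big_set1 mem_edge_of //= (adj_neq Guw).
rewrite exchange_big /= big_setU1 //= big_set1.
have D t : \sum_i x 0 i * (t == enum_val i)%:R = y t.
  rewrite (bigD1 (enum_rank t)) //= enum_rankK eqxx mulr1 big1 ?addr0 // => k kt.
  case: eqP => [tk|_]; last by rewrite mulr0.
  by rewrite tk enum_valK eqxx in kt.
by rewrite !D.
Qed.

(** Boundaries are cycles, and the two spaces agree because Euler's formula makes
   the dimension of the cycle space, at most [#|edges G| - (#|V| - 1)], equal to
   the dimension of the boundary space, at least [#|faces N| - 1]. Here [x] is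
   the indicator of a set of faces whose boundary is [z]. *)
Lemma cycle_bounds (z : {set V} -> 'F_2) :
  (forall v, \sum_(e in edges G) z e * (v \in e)%:R = 0) ->
  exists2 x : V * V -> 'F_2,
    forall d, d \in darts G -> x (step d) = x d &
    forall d, d \in darts G -> x d + x (flip d) = z (edge_of d).
Proof.
move=> zcyc; pose zr : 'rV_(#|edges G|) := \row_j z (enum_val j).
have zker : (zr <= kermx incid)%MS.
  apply/sub_kermxP/rowP => k; rewrite !mxE -[RHS](zcyc (enum_val k)).
  rewrite (big_enum_val (fun e => z e * (enum_val k \in e)%:R)) /=.
  by apply: eq_bigr => j _; rewrite !mxE.
have bker : (bdry <= kermx incid)%MS by apply/sub_kermxP/bdry_incid.
have /submxP[x zx] : (zr <= bdry)%MS.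
  apply: (submx_trans zker).
  rewrite -(mxrank_leqif_sup bker) eqn_leq mxrankS //= mxrank_ker leq_subLR.
  have := leq_add rank_incid rank_bdry; rewrite hplane !addSn !addnS addn0 !ltnS.
  by [].
exists (face_fun x) => d dG; first exact: face_fun_step.
have eG := mem_edges dG.
by rewrite -(bdryE x dG (enum_rankK_in eG eG)) -zx mxE enum_rankK_in.
Qed.

End Homology.

(** * Separation by cycles *)

Section Separation.
Import GRing.Theory.
Local Open Scope ring_scope.
Variables (V : finType) (G : sgraph V) (N : rotation G).
Implicit Types (S : {set {set V}}).
Local Notation step := (face_step N).

(** The edges of a walk, counted modulo 2, form a chain whose boundary is the two
   ends, since every inner visit to a vertex contributes two edges. *)
Lemma walk_chain (r : rel V) a b :
    (forall p q, r p q -> G p q) -> connect r a b ->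
  exists2 z : {set V} -> 'F_2,
    forall d, z (edge_of d) != 0 -> r d.1 d.2 \/ r d.2 d.1 &
    forall v, \sum_(e in edges G) z e * (v \in e)%:R = (a == v)%:R + (b == v)%:R.
Proof.
move=> rG /connectP[p]; elim: p a => [|w p IH] a /=.
  move=> _ ->; exists (fun=> 0) => [d|v]; first by rewrite eqxx.
  by rewrite addFF big1 // => e _; rewrite mul0r.
case/andP=> raw pth lst; have [z zr zb] := IH w pth lst.
have awG : (a, w) \in darts G by rewrite dartE rG.
exists (fun e => z e + (edge_of (a, w) == e)%:R) => [d|v].
  case: (edge_of (a, w) =P edge_of d) => [/edge_of_eq[] E _|_].
  - by left; case: d E => u v [<- <-].
  - by right; case: d E => u v [<- <-].
  by rewrite addr0; apply: zr.
under eq_bigr do rewrite mulrDl.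
rewrite big_split /= zb sum_delta mem_edges // mul1r mem_edge_of ?dart_neq //=.
  by rewrite [X in X + _]addrC addrACA addFF addr0 addrC.
exact: dart_neq awG.
Qed.

Hypothesis hplane : plane N.
Hypothesis conn : forall u v, connect G u v.

(** Closing a walk that avoids [y] by the edges from [y] to [a] and [b] gives a
   cycle, and [x] tells its two sides apart. Around [y] the side changes
   exactly at these two edges. *)
Lemma two_sides (r : rel V) y a b :
    (forall p q, r p q -> [/\ G p q, p != y & q != y]) ->
    G y a -> G y b -> a != b -> connect r a b ->
  exists x : V * V -> 'F_2,
    [/\ forall d, d \in darts G -> x (step d) = x d,
        forall d, d \in darts G -> x (flip d) != x d ->
          [\/ r d.1 d.2, r d.2 d.1, edge_of d = edge_of (y, a) |
              edge_of d = edge_of (y, b)] &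
        forall w, G y w -> x (w, y) = x (y, w) + (a == w)%:R + (b == w)%:R].
Proof.
move=> rG Gya Gyb nab rab.
have rG' p q : r p q -> G p q by case/rG.
have [z zr zb] := walk_chain rG' rab.
pose z' e := z e + (edge_of (y, a) == e)%:R + (edge_of (y, b) == e)%:R.
have yaG : (y, a) \in darts G by rewrite dartE.
have ybG : (y, b) \in darts G by rewrite dartE.
case: (cycle_bounds hplane conn (z := z')) => [v|x xs xf].
  rewrite /z'; under eq_bigr do rewrite !mulrDl.
  rewrite !big_split /= zb !sum_delta !mem_edges // !mul1r.
  rewrite !mem_edge_of ?(dart_neq yaG) ?(dart_neq ybG) //=.
  by rewrite -addrA [X in _ + X]addrACA (addFF (y == v)%:R) add0r addFF.
exists x; split=> // [d dG|w Gyw].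
  move=> nx; have : z' (edge_of d) != 0.
    by rewrite -xf //; apply: contra nx => /eqP/addF_eq0->.
  rewrite /z'; case: (edge_of (y, a) =P _) => [->|_]; first by constructor 3.
  case: (edge_of (y, b) =P _) => [->|_]; first by constructor 4.
  by rewrite !addr0 => /zr[]; [constructor 1 | constructor 2].
have ywG : (y, w) \in darts G by rewrite dartE.
have := xf _ ywG; rewrite /z' /flip /=.
have -> : z (edge_of (y, w)) = 0.
  by apply/eqP/negbNE/negP => /zr[] /rG[]; rewrite /= eqxx.
have E c : (edge_of (y, c) == edge_of (y, w)) = (c == w).
  apply/eqP/eqP => [/edge_of_eq[[]//|[yw cy]]|-> //].
  by move: Gyw; rewrite -yw adj_irr.
rewrite !E add0r -addrA => <-.
by rewrite addrA addFF add0r.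
Qed.

(** Turning around [y] from [a] to [b] stays on one side of such a cycle, and ends
   on the other one. The dart [(w, y)] stands for the corner at [y] that follows
   [w]. *)
Lemma rot_arc (x : V * V -> 'F_2) y a b :
    (forall d, d \in darts G -> x (step d) = x d) ->
    (forall w, G y w -> x (w, y) = x (y, w) + (a == w)%:R + (b == w)%:R) ->
    G y a -> G y b -> a != b ->
  exists i, [/\ (0 < i)%N, iter i (N y) a = b,
    forall j, (j < i)%N -> x (iter j (N y) a, y) = x (a, y) &
    x (b, y) = x (a, y) + 1].
Proof.
move=> xs xy Gya Gyb nab.
have Git j : G y (iter j (N y) a).
  by apply: (iter_in (S := G y)) => //; apply: rot_nbr.
have ex : exists i, iter i (N y) a == b.
  by exists (findex (N y) a b); apply/eqP/iter_findex/rot_next_cyclic.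
case: (ex_minnP ex) => i /eqP ib imin.
have i0 : (0 < i)%N by case: i ib {imin} => // /= E; rewrite E eqxx in nab.
have turn j : x (iter j.+1 (N y) a, y) = x (iter j (N y) a, y) +
    (a == iter j.+1 (N y) a)%:R + (b == iter j.+1 (N y) a)%:R.
  rewrite xy //; congr (_ + _ + _).
  by rewrite -(xs (iter j (N y) a, y)) // dartE adj_sym.
have back j : (0 < j <= i)%N -> (a == iter j (N y) a) = false.
  case/andP=> j0 ji; apply/eqP => E.
  have := imin (i - j)%N; rewrite {1}E -iterD subnK // ib eqxx => /(_ isT).
  by rewrite leqNgt ltn_subrL j0 i0.
have const j : (j < i)%N -> x (iter j (N y) a, y) = x (a, y).
  elim: j => // j IH ji; rewrite turn IH ?(ltnW ji) // back ?(ltnW ji) // addr0.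
  case: eqP => [E|_]; last by rewrite addr0.
  by have := imin j.+1; rewrite -E eqxx => /(_ isT); rewrite leqNgt ji.
exists i; split=> //.
case: i i0 ib back const {imin} => // i _ ib back const.
by rewrite -ib turn back ?leqnn // ib eqxx const // addr0.
Qed.

Definition intact (S : {set {set V}}) d :=
  [forall (d' | d' \in face_at N d), edge_of d' \in S].

Lemma intactP S d :
  reflect (forall d', d' \in face_at N d -> edge_of d' \in S) (intact S d).
Proof. exact: forall_inP. Qed.

Lemma intact_face S d d' :
  d \in darts G -> d' \in face_at N d -> intact S d' = intact S d.
Proof. by move=> dG d'd; rewrite /intact (face_at_eq dG d'd). Qed.

Lemma intact_step S d : d \in darts G -> intact S (step d) = intact S d.
Proof. by move=> dG; apply: (intact_face _ dG); apply: mem_step. Qed.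

(** The broken faces form a single region once faces are glued along the edges
   outside [S]. Connectedness is put as constancy of the functions on faces that
   agree across these edges, since such functions are what [two_sides]
   provides. *)
Definition glued (S : {set {set V}}) := forall x : V * V -> 'F_2,
  (forall d, d \in darts G -> x (step d) = x d) ->
  (forall d, d \in darts G -> edge_of d \notin S -> x (flip d) = x d) ->
  {in darts G &, forall d d', ~~ intact S d -> ~~ intact S d' -> x d = x d'}.

(** All corners at [y] met when turning from the edge of [a] to that of [b]
   belong to intact faces. *)
Definition intact_arc S y a b := exists i,
  [/\ (0 < i)%N, iter i (N y) a = b &
      forall j, (j < i)%N -> intact S (iter j (N y) a, y)].

Definition within S := [rel p q | G p q && (edge_of (p, q) \in S)].

(** A cycle of [S] has all broken faces on one side, because they are glued along
   edges off the cycle; the corners at [y] on its other side are intact. *)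
Lemma arc_of_cycle S y a b : glued S ->
    G y a -> G y b -> edge_of (y, a) \in S -> edge_of (y, b) \in S ->
    a != b -> connect (avoid (within S) y) a b ->
  intact_arc S y a b \/ intact_arc S y b a.
Proof.
move=> gS Gya Gyb yaS ybS nab cab.
have [p q /and3P[/andP[]] //|x [xs xf xy]] := two_sides _ Gya Gyb nab cab.
have [i [i0 ib ic xb]] := rot_arc xs xy Gya Gyb nab.
have xy' w : G y w -> x (w, y) = x (y, w) + (b == w)%:R + (a == w)%:R.
  by move=> Gyw; rewrite xy // addrAC.
have nba : b != a by rewrite eq_sym.
have [k [k0 kb kc _]] := rot_arc xs xy' Gyb Gya nba.
have Gi c : G y c -> forall j, (iter j (N y) c, y) \in darts G.
  move=> Gc j; rewrite dartE adj_sym.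
  by apply: (iter_in (S := G y)) => //; apply: rot_nbr.
have xS d : d \in darts G -> edge_of d \notin S -> x (flip d) = x d.
  move=> dG; apply: contraNeq => /xf[] //; case: d dG => u v _ /=.
  - by case/andP => /andP[].
  - by case/andP => /andP[_ +] _; rewrite (edge_flip (u, v)).
  - by move=> ->.
  - by move=> ->.
case: (boolP [exists d in darts G, ~~ intact S d && (x d == x (a, y))]).
  case/exists_inP => d dG /andP[nd /eqP xd]; right; exists k; split=> // j jk.
  apply: contraT => nj.
  have := gS x xs xS _ _ dG (Gi b Gyb j) nd nj.
  by rewrite kc // xd xb => /eqP; rewrite -subr_eq0 opprD addrA subrr.
move/exists_inPn => noN; left; exists i; split=> // j ji.
by have := noN _ (Gi a Gya j); rewrite ic // eqxx andbT negbK.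
Qed.

Hypothesis nocut : forall y a b, a != y -> b != y ->
  connect (avoid G y) a b.

(** If a face had two corners at [y], following [a] and [b], then a cycle through
   the edges from [y] to [a] and [b] would have this face on both sides. Such a
   cycle exists as [y] is no cut vertex. *)
Lemma face_head_inj a b y : (a, y) \in darts G -> (b, y) \in darts G ->
  (b, y) \in face_at N (a, y) -> a = b.
Proof.
move=> ayG byG bF; apply/eqP; apply: contraT => nab.
have [Gay Gby] : G a y /\ G b y by rewrite -!dartE.
have [Gya Gyb] : G y a /\ G y b by rewrite !(adj_sym G y).
have cab : connect (avoid G y) a b.
  by apply: nocut; [apply: adj_neq Gay | apply: adj_neq Gby].
have [p q /and3P[] //|x [xs _ xy]] := two_sides _ Gya Gyb nab cab.
have [i [_ _ _]] := rot_arc xs xy Gya Gyb nab.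
suff -> : x (b, y) = x (a, y).
  by move/eqP; rewrite -subr_eq0 opprD addrA subrr.
move: bF; rewrite inE => /iter_findex <-; elim: findex => //= n <-.
by apply: xs; apply: (iter_in (S := mem (darts G))) => //; apply: step_dart.
Qed.

End Separation.

(** * Colouring one face *)

(** Colours along a cycle of length [k] whose first and last edges get prescribed
   colours [x] and [y]. The unique 3 is at position 0 or 1, and the alternation
   of 1 and 2 is anchored at the last edge, which gets [y]. Two constraints, one
   at either end, can always be met with [y] among 1 and 2 and [x] among the
   other two colours. *)
Section CycleColors.
Variables (x y k : nat).
Hypotheses (y12 : (y == 1) || (y == 2)) (x3 : (x == 3 - y) || (x == 3)).

Definition cycle_top : nat := x != 3.

Definition cycle_color i :=
  if i == 0 then x
  else if (i == 1) && (x != 3) then 3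
  else if odd (k.-1 - i) then 3 - y else y.

Lemma cycle_color_max i : i != cycle_top -> 1 <= cycle_color i <= 2.
Proof.
rewrite /cycle_color /cycle_top; case/orP: y12 x3 => /eqP-> /orP[]/eqP->;
  by case: i => [|[|i]] //= _; case: ifP.
Qed.

Lemma cycle_color_top : cycle_color cycle_top = 3.
Proof.
by rewrite /cycle_color /cycle_top; case: (x =P 3).
Qed.

Lemma cycle_color_next i : i.+1 < k -> cycle_color i != cycle_color i.+1.
Proof.
move=> ik; case: (eqVneq i cycle_top) => [->|ni].
  rewrite cycle_color_top; have := @cycle_color_max cycle_top.+1.
  rewrite eqn_leq ltnn /= => /(_ isT); case/andP => _; rewrite -ltnS.
  by rewrite eq_sym neq_ltn => ->.
case: (eqVneq i.+1 cycle_top) => [->|ni1].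
  rewrite cycle_color_top neq_ltn.
  by have /andP[_] := cycle_color_max ni; rewrite -ltnS => ->.
rewrite /cycle_color; move: ni ni1; rewrite /cycle_top => ni ni1.
have i0 : i != 0 by case: i ik ni ni1 => //=; case: (x == 3).
rewrite (negPf i0) /=.
have -> : (i == 1) && (x != 3) = false.
  by apply/negP => /andP[/eqP i1 nx]; rewrite i1 nx in ni.
have -> : (i.+1 == 1) = false by rewrite eqSS (negPf i0).
have -> : k.-1 - i = (k.-1 - i.+1).+1.
  by rewrite subnS prednK // subn_gt0 ltn_predRL.
rewrite /=; case: (odd _) => /=; by case/orP: y12 => /eqP->.
Qed.

Lemma cycle_color_last : 2 < k -> cycle_color k.-1 = y.
Proof. by rewrite /cycle_color; case: k => [|[|[|n]]] // _; rewrite /= subnn. Qed.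

End CycleColors.

Lemma third_color a b : exists2 k, 1 <= k <= 3 & (k != a) && (k != b).
Proof.
case: (boolP ((1 != a) && (1 != b))) => H1; first by exists 1.
case: (boolP ((2 != a) && (2 != b))) => H2; first by exists 2.
exists 3 => //; move: H1 H2.
by case: a => [|[|[|[|a]]]]; case: b => [|[|[|[|b]]]].
Qed.

(** * Peeling steps *)

Section Reductions.
Variables (V : finType) (G : sgraph V) (N : rotation G).
Implicit Types (S : {set {set V}}) (e f : {set V}) (d : V * V).
Local Notation step := (face_step N).
Local Notation intact := (intact N).

Lemma fadj_sym : symmetric (facially_adjacent N).
Proof.
move=> e f; rewrite /facially_adjacent eq_sym; congr (_ && _).
by apply/eq_existsb => d; rewrite orbC.
Qed.

Lemma fadj_cases a b f : G a b -> facially_adjacent N (edge_of (a, b)) f ->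
  [\/ f = edge_of (b, N b a), f = edge_of (b, rot_prev N b a),
      f = edge_of (a, N a b) | f = edge_of (a, rot_prev N a b)].
Proof.
move=> Gab /andP[_ /exists_inP[[u v] dG]]; rewrite dartE in dG.
rewrite /face_step /=; case/orP=> /andP[/eqP E1 /eqP E2].
  rewrite E2; case/edge_of_eq: E1 => [[-> ->]|[-> ->]].
    by constructor 1.
  by constructor 3.
rewrite E1; move: E2.
have GNvu : G v (N v u) by apply: rot_next_adj; rewrite adj_sym.
case/edge_of_eq => [[-> ->]|[-> ->]].
  by constructor 4; rewrite edgeC rot_nextK // adj_sym.
by constructor 2; rewrite edgeC rot_nextK // adj_sym.
Qed.

Lemma fadj_same_face e f : facially_adjacent N e f ->
  exists d d', [/\ d \in darts G, d' \in face_at N d, e = edge_of d &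
                   f = edge_of d'].
Proof.
case/andP=> _ /exists_inP[d dG]; have sd := mem_step N d.
case/orP=> /andP[/eqP-> /eqP->]; first by exists d, (step d).
exists (step d), d; split=> //; first exact: step_dart.
exact: face_at_sym.
Qed.

(** What a colouring of [S] must satisfy so that it extends to the peeled edges.
   Broken faces are settled by the edges already peeled, which is why nothing
   but the absence of colour 4 is asked of them. *)
Definition partial_fum S (c : {set V} -> nat) := [/\
  forall e, e \in S -> 1 <= c e <= 4,
  {in S &, forall e f, facially_adjacent N e f -> c e != c f},
  forall d, d \in darts G -> intact S d -> exists2 d0, d0 \in face_at N d &
    forall d', d' \in face_at N d -> edge_of d' != edge_of d0 ->
      c (edge_of d') < c (edge_of d0) &
  forall d, d \in darts G -> ~~ intact S d -> edge_of d \in S ->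
    c (edge_of d) <= 3].

Definition colorable S := exists c, partial_fum S c.

Lemma intact_sub S S' d : S' \subset S -> intact S' d -> intact S d.
Proof.
by move=> /subsetP sub /intactP H; apply/intactP => d' /H/sub.
Qed.

Lemma intactW S d : intact S d -> edge_of d \in S.
Proof. by move/intactP; apply; apply: face_at_refl. Qed.

Lemma intact_setD1 S d d1 : d \in darts G -> d1 \in darts G ->
    ~~ (intact S d) -> ~~ (intact S (flip d)) ->
  intact S d1 -> intact (S :\ edge_of d) d1.
Proof.
move=> dG d1G nd nfd iS; apply/intactP => d' d'd1; have d'G := face_at_dart d1G d'd1.
rewrite in_setD1 (intactP _ _ _ iS) // andbT.
have id' : intact S d' by rewrite (intact_face _ d1G).
apply/eqP => /edge_of_eq[E|E]; first by rewrite -E id' in nd.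
by rewrite -E id' in nfd.
Qed.

(** Two coloured neighbours leave one of the colours 1, 2, 3 free, and since
   both faces are broken any of these is harmless. *)
Lemma drop_edge S d e1 e2 : d \in darts G -> edge_of d \in S ->
    ~~ intact S d -> ~~ intact S (flip d) ->
    (forall f, f \in S -> facially_adjacent N (edge_of d) f -> f = e1 \/ f = e2) ->
  colorable (S :\ edge_of d) -> colorable S.
Proof.
move=> dG dS nd nfd nbr [c [crng cadj ctop clow]].
have sub := subD1set S (edge_of d).
have [k k3 /andP[k1 k2]] := third_color (c e1) (c e2).
have k4 : 1 <= k <= 4 by case/andP: k3 => -> /= /leqW.
pose c' e := if e == edge_of d then k else c e.
have c'E e : e != edge_of d -> c' e = c e by rewrite /c' => /negPf->.
have in' e : e \in S -> e != edge_of d -> e \in S :\ edge_of d.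
  by move=> eS ne; rewrite in_setD1 ne.
have c'adj f : f \in S -> f != edge_of d ->
    facially_adjacent N (edge_of d) f -> c' (edge_of d) != c' f.
  move=> fS fd /(nbr _ fS) fe; rewrite (c'E f) // /c' eqxx.
  by case: fe => ->.
exists c'; split.
- by move=> e eS; rewrite /c'; case: eqP => // /eqP ne; apply: crng; apply: in'.
- move=> e f eS fS; have [->|ne] := eqVneq e (edge_of d).
    have [->|nf] := eqVneq f (edge_of d); first by case/andP; rewrite eqxx.
    exact: c'adj.
  have [->|nf] := eqVneq f (edge_of d); first by rewrite fadj_sym eq_sym; apply: c'adj.
  by rewrite !c'E //; apply: cadj; apply: in'.
- move=> d1 d1G i1; have i1' := intact_setD1 dG d1G nd nfd i1.
  have [d0 d0F mx] := ctop _ d1G i1'; exists d0 => // d' d'F d'0.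
  have nF d2 : d2 \in face_at N d1 -> edge_of d2 != edge_of d.
    by move=> d2F; have /intactP/(_ _ d2F) := i1'; rewrite in_setD1 => /andP[].
  by rewrite !c'E ?nF //; apply: mx.
- move=> d1 d1G n1 d1S; rewrite /c'; case: eqP => [_|/eqP ne].
    by case/andP: k3.
  apply: clow => //; last exact: in'.
  by apply: contra n1; apply: intact_sub.
Qed.

(** Losing [d] breaks both of its faces, so their other edges, the only
   possible neighbours of [d], carry no 4. *)
Lemma drop_top S d : d \in darts G -> intact S d -> intact S (flip d) ->
  colorable (S :\ edge_of d) -> colorable S.
Proof.
move=> dG id ifd [c [crng cadj ctop clow]].
have sub := subD1set S (edge_of d).
pose c' e := if e == edge_of d then 4 else c e.
have c'E e : e != edge_of d -> c' e = c e by rewrite /c' => /negPf->.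
have c'd : c' (edge_of d) = 4 by rewrite /c' eqxx.
have in' e : e \in S -> e != edge_of d -> e \in S :\ edge_of d.
  by move=> eS ne; rewrite in_setD1 ne.
have low d1 d2 : d1 \in darts G -> d2 \in face_at N d1 ->
    edge_of d1 = edge_of d -> edge_of d2 \in S -> edge_of d2 != edge_of d ->
    c' (edge_of d2) <= 3.
  move=> d1G d2F d1d d2S nd; rewrite c'E //.
  apply: clow; [exact: face_at_dart d2F| |exact: in'].
  apply/negP => /intactP/(_ d1); rewrite (face_at_eq d1G d2F) face_at_refl.
  by rewrite d1d setD11 => /(_ isT).
have c'adj f : f \in S -> f != edge_of d ->
    facially_adjacent N (edge_of d) f -> c' (edge_of d) != c' f.
  move=> fS fd /fadj_same_face[d1 [d2 [d1G d2F d1d fE]]].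
  rewrite c'd eq_sym neq_ltn; apply/orP; left; rewrite ltnS fE.
  by apply: (low d1); rewrite // -fE.
exists c'; split.
- by move=> e eS; rewrite /c'; case: eqP => // /eqP ne; apply: crng; apply: in'.
- move=> e f eS fS; have [->|ne] := eqVneq e (edge_of d).
    have [->|nf] := eqVneq f (edge_of d); first by case/andP; rewrite eqxx.
    exact: c'adj.
  have [->|nf] := eqVneq f (edge_of d); first by rewrite fadj_sym eq_sym; apply: c'adj.
  by rewrite !c'E //; apply: cadj; apply: in'.
- move=> d1 d1G i1.
  case: (boolP [exists d2 in face_at N d1, edge_of d2 == edge_of d]).
    case/exists_inP=> d2 d2F /eqP d2d; exists d2 => // d' d'F.
    rewrite d2d c'd => nd'; have d2G := face_at_dart d1G d2F.
    rewrite ltnS; apply: (low d2) => //; first by rewrite (face_at_eq d1G d2F).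
    by move/intactP: i1; apply.
  move/exists_inPn => nF.
  have i1' : intact (S :\ edge_of d) d1.
    by apply/intactP => d' d'F; rewrite in_setD1 nF // (intactP _ _ _ i1).
  have [d0 d0F mx] := ctop _ d1G i1'; exists d0 => // d' d'F d'0.
  by rewrite !c'E ?nF //; apply: mx.
- move=> d1 d1G n1 d1S; rewrite c'E.
    apply: clow => //; last apply: in' => //; last first.
      apply: contra n1 => /eqP/edge_of_eq[]-> //.
    by apply: contra n1; apply: intact_sub.
  by apply: contra n1 => /eqP/edge_of_eq[]->.
Qed.

Hypothesis rot_neq : forall u v, G u v -> N u v != v.
Hypothesis head_inj : forall d d', d \in darts G -> d' \in face_at N d ->
  d.2 = d'.2 -> d = d'.

(** Consequences of the boundary of a face being a cycle of length at least 3. *)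
Section OneFace.
Variable d0 : V * V.
Hypothesis d0G : d0 \in darts G.
Local Notation F := (face_at N d0).
Local Notation k := (order step d0).

Lemma face_tail_inj d d' : d \in F -> d' \in F -> d.1 = d'.1 -> d = d'.
Proof.
move=> dF d'F E; have [b bF bd] := face_pred d0G dF.
have [b' b'F b'd'] := face_pred d0G d'F.
have bG := face_at_dart d0G bF.
rewrite -bd -b'd'; congr step; apply: head_inj => //.
  by rewrite (face_at_eq d0G bF).
by move: E; rewrite -bd -b'd'.
Qed.

Lemma face_head_eq d d' : d \in F -> d' \in F -> d.2 = d'.2 -> d = d'.
Proof.
move=> dF d'F; apply: head_inj; first exact: face_at_dart dF.
by rewrite (face_at_eq d0G dF).
Qed.

Lemma face_edge_inj : {in F &, injective (@edge_of V)}.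
Proof.
move=> d d' dF d'F /edge_of_eq[//|E].
have d'G := face_at_dart d0G d'F.
have sF := face_step_mem d0G d'F.
have := face_tail_inj dF sF; rewrite E /= => /(_ erefl) [] /esym/eqP.
by rewrite (negPf (rot_neq _)) // -dartE (dart_flip _ d').
Qed.

Lemma face_size : 2 < k.
Proof.
have := iter_order_in (@step_dart _ _ N) (@step_inj _ _ N) d0G.
have := order_gt0 step d0; case: d0 d0G => a b; rewrite dartE => Gab.
case: (order _ _) => [|[|[|n]]] //= _ [].
  by move=> /eqP; rewrite eq_sym (negPf (adj_neq Gab)).
by move=> /eqP; rewrite (negPf (rot_neq _)) // adj_sym.
Qed.

Lemma face_dartP d :
  reflect (exists2 i, i < k & d = iter i step d0) (d \in F).
Proof.
rewrite inE; apply: (iffP idP) => [dF|[i _ ->]]; last exact: fconnect_iter.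
by exists (findex step d0 d); rewrite ?findex_max ?iter_findex.
Qed.

Definition face_edges := [seq edge_of d | d <- orbit step d0].

Lemma index_face_edges i : i < k ->
  index (edge_of (iter i step d0)) face_edges = i.
Proof.
move=> ik; have sz : size face_edges = k by rewrite size_map size_orbit.
have <- : nth set0 face_edges i = edge_of (iter i step d0).
  by rewrite (nth_map d0) ?size_orbit // nth_traject.
rewrite index_uniq ?sz // map_inj_in_uniq ?orbit_uniq // => a b.
rewrite -!fconnect_orbit => aF bF; apply: face_edge_inj; rewrite inE //.
Qed.

Lemma boundaryP e :
  reflect (exists2 d, d \in F & e = edge_of d) (e \in boundary F).
Proof. exact: imsetP. Qed.

(** An edge of the cycle can meet another one outside the face only at a vertex
   of degree 2, where it also meets it inside. *)
Lemma fadj_boundary d f : d \in F -> f \in boundary F ->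
    facially_adjacent N (edge_of d) f ->
  f = edge_of (step d) \/ exists2 d', d' \in F & d = step d' /\ f = edge_of d'.
Proof.
case: d => a b dF /boundaryP[d' d'F ->] adj.
have dG := face_at_dart d0G dF; have Gab : G a b by rewrite -dartE.
have Gba : G b a by rewrite adj_sym.
have sF := face_step_mem d0G dF.
have [d1 d1F d1d] := face_pred d0G dF.
have d1E : d1 = (rot_prev N a b, a).
  have d1G := face_at_dart d0G d1F; case: d1 d1d d1G {d1F} => p q [-> <-].
  by rewrite dartE => Gpa; rewrite rot_nextK // adj_sym.
case: (fadj_cases Gab adj) => E.
- by left.
- left; case/edge_of_eq: (E) => d'E; rewrite d'E in d'F *.
    by rewrite -(face_tail_inj sF d'F).
  have [] := face_head_eq dF d'F erefl => pa.
  by have := rot_neq Gba; rewrite {1}pa rot_prevK // eqxx.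
- right; exists d1 => //; split=> //; rewrite d1E in d1F *.
  case/edge_of_eq: (E) => d'E; rewrite d'E in d'F *.
    have [] := face_tail_inj dF d'F erefl => /esym/eqP.
    by rewrite (negPf (rot_neq Gab)).
  by rewrite (face_head_eq d'F d1F).
- by right; exists d1 => //; split=> //; rewrite E d1E edgeC.
Qed.

(** The tail [d0.1] is the only vertex at which the rest of [S] may constrain the
   face: there it forbids one colour for the edge leaving it and one for the
   edge entering it. *)
Lemma drop_face S : intact S d0 ->
    (forall d, d \in F -> ~~ intact S (flip d)) ->
    (forall a b, (a, b) \in F ->
       (b != d0.1 -> edge_of (b, rot_prev N b a) \in S ->
          edge_of (b, rot_prev N b a) \in boundary F) /\
       (a != d0.1 -> edge_of (a, N a b) \in S ->
          edge_of (a, N a b) \in boundary F)) ->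
  colorable (S :\: boundary F) -> colorable S.
Proof.
move=> i0 nflip outer [c [crng cadj ctop clow]].
have sub := subsetDl S (boundary F).
pose p := d0.1; pose dl := iter k.-1 step d0.
pose beta := c (edge_of (p, rot_prev N p dl.1)).
pose alpha := c (edge_of (p, N p d0.2)).
have k2 := face_size; have k0 : 0 < k by apply: ltn_trans k2.
have [y y12 yb] : exists2 y, (y == 1) || (y == 2) & y != beta.
  by case: (eqVneq 1 beta) => [<-|]; [exists 2 | exists 1].
have [x x3 xa] : exists2 x, (x == 3 - y) || (x == 3) & x != alpha.
  case: (eqVneq (3 - y) alpha) => [<-|]; last by exists (3 - y); rewrite ?eqxx.
  by exists 3; rewrite ?eqxx ?orbT //; case/orP: y12 => /eqP->.
have xy : x != y by case/orP: y12 x3 => /eqP-> /orP[]/eqP->.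
pose col := cycle_color x y k.
pose c' e := if e \in boundary F then col (index e face_edges) else c e.
have c'F i : i < k -> c' (edge_of (iter i step d0)) = col i.
  move=> ik; rewrite /c' index_face_edges // ifT //.
  by apply/boundaryP; exists (iter i step d0) => //; apply/face_dartP; exists i.
have c'E e : e \notin boundary F -> c' e = c e by rewrite /c' => /negPf->.
have in' e : e \in S -> e \notin boundary F -> e \in S :\: boundary F.
  by move=> eS ne; rewrite in_setD ne.
have dlF : dl \in F by apply/face_dartP; exists k.-1; rewrite // prednK.
have sdl : step dl = d0.
  rewrite -iterS prednK //.
  exact: (iter_order_in (@step_dart _ _ N) (@step_inj _ _ N) d0G).
have dl2 : dl.2 = p by rewrite /p -sdl.
have c'0 : c' (edge_of d0) = x by rewrite (c'F 0).
have c'l : c' (edge_of dl) = y by rewrite c'F ?prednK // /col cycle_color_last.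
have c'next d : d \in F -> c' (edge_of d) != c' (edge_of (step d)).
  case/face_dartP => i ik ->; rewrite -iterS.
  have [ik1|] := ltnP i.+1 k; first by rewrite !c'F //; apply: cycle_color_next.
  move=> ki; have -> : i = k.-1 by apply/eqP; rewrite eqn_leq -ltnS prednK // ik -ltnS prednK.
  by rewrite iterS -/dl sdl c'l c'0 eq_sym.
have c'rng d : d \in F -> 1 <= c' (edge_of d) <= 3.
  case/face_dartP => i ik ->; rewrite c'F //.
  have [->|ni] := eqVneq i (cycle_top x); first by rewrite /col cycle_color_top.
  by have /andP[-> /leqW] := cycle_color_max k y12 x3 ni.
have c'adj d f : d \in F -> f \in S -> facially_adjacent N (edge_of d) f ->
    c' (edge_of d) != c' f.
  move=> dF fS adj; have [fF|fF] := boolP (f \in boundary F).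
    case: (fadj_boundary dF fF adj) => [->|[d' d'F [-> ->]]]; first exact: c'next.
    by rewrite eq_sym c'next.
  have dG := face_at_dart d0G dF; rewrite (c'E f) //.
  have [d1 d1F d1d] := face_pred d0G dF.
  case: d dF adj dG d1d => a b dF adj; rewrite dartE => Gab d1d.
  case: (fadj_cases Gab adj) => E.
  - case/negP: fF; rewrite E; apply/boundaryP; exists (step (a, b)) => //.
    exact: face_step_mem.
  - have [out _] := outer _ _ dF; have [bp|bp] := eqVneq b p; last first.
      by rewrite E out -?E in fF.
    have dE : (a, b) = dl by apply: face_head_eq; rewrite ?dl2.
    by rewrite dE c'l E bp -[a]/((a, b).1) dE.
  - have [_ out] := outer _ _ dF; have [ap|ap] := eqVneq a p; last first.
      by rewrite E out -?E in fF.
    have dE : (a, b) = d0.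
      by apply: face_tail_inj => //; apply: face_at_refl.
    by rewrite dE c'0 E ap -[b]/((a, b).2) dE.
  - case/negP: fF; rewrite E; apply/boundaryP; exists d1 => //.
    have d1G := face_at_dart d0G d1F; case: d1 d1d d1G {d1F} => u v [-> <-].
    by rewrite dartE => Gua; rewrite edgeC rot_nextK // adj_sym.
exists c'; split.
- move=> e eS; have [/boundaryP[d dF ->]|ne] := boolP (e \in boundary F).
    by have /andP[-> /leqW] := c'rng _ dF.
  by rewrite c'E //; apply: crng; apply: in'.
- move=> e f eS fS; have [/boundaryP[d dF ->]|ne] := boolP (e \in boundary F).
    exact: c'adj.
  have [/boundaryP[d dF ->]|nf] := boolP (f \in boundary F).
    by rewrite fadj_sym eq_sym; apply: c'adj.
  by rewrite !c'E //; apply: cadj; apply: in'.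
- move=> d1 d1G i1; have [d1F|d1F] := boolP (d1 \in F).
    rewrite (face_at_eq d0G d1F).
    have jk : cycle_top x < k.
      by rewrite /cycle_top; case: (x != 3); [apply: ltnW | apply: k0].
    exists (iter (cycle_top x) step d0).
      by apply/face_dartP; exists (cycle_top x).
    move=> d' /face_dartP[i ik ->]; rewrite !c'F //.
    have [->|ni _] := eqVneq i (cycle_top x); first by rewrite eqxx.
    by rewrite /col cycle_color_top; have /andP[] := cycle_color_max k y12 x3 ni.
  have nF d2 : d2 \in face_at N d1 -> edge_of d2 \notin boundary F.
    move=> d2F; apply/boundaryP => -[d dF /edge_of_eq[]E]; last first.
      by have := nflip _ dF; rewrite -E (intact_face _ d1G) // i1.
    case/negP: d1F; rewrite -(face_at_eq d0G dF) -E (face_at_eq d1G d2F).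
    exact: face_at_refl.
  have i1' : intact (S :\: boundary F) d1.
    by apply/intactP => d' d'F; rewrite in_setD nF // (intactP _ _ _ i1).
  have [d2 d2F mx] := ctop _ d1G i1'; exists d2 => // d' d'F d'0.
  by rewrite !c'E ?nF //; apply: mx.
- move=> d1 d1G n1 d1S; have [/boundaryP[d dF ->]|nd1] := boolP (edge_of d1 \in boundary F).
    by have /andP[] := c'rng _ dF.
  rewrite c'E //; apply: clow => //; last exact: in'.
  by apply: contra n1; apply: intact_sub.
Qed.

End OneFace.
End Reductions.

(** * Peeling never gets stuck *)

Section Peeling.
Variables (V : finType) (G : sgraph V) (N : rotation G).
Implicit Types (S : {set {set V}}) (e f : {set V}) (d : V * V).
Local Notation step := (face_step N).
Local Notation intact := (intact N).
Local Notation colorable := (colorable N).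
Local Notation glued := (glued N).

Lemma face_const (T : Type) (x : V * V -> T) d d' :
    (forall d, d \in darts G -> x (step d) = x d) ->
  d \in darts G -> d' \in face_at N d -> x d' = x d.
Proof.
move=> xs dG; rewrite inE => /iter_findex <-; elim: findex => //= n <-.
by apply: xs; apply: (iter_in (S := mem (darts G))) => //; apply: step_dart.
Qed.

Definition respects S (x : V * V -> 'F_2) :=
  (forall d, d \in darts G -> x (step d) = x d) /\
  (forall d, d \in darts G -> edge_of d \notin S -> x (flip d) = x d).

(** Shrinking [S] keeps the broken region connected as soon as each newly broken
   face is glued to an old one. *)
Lemma glued_shrink S S' : S' \subset S -> glued S ->
    (forall x, respects S' x -> forall d, d \in darts G ->
       intact S d -> ~~ intact S' d ->
     exists d', [/\ d' \in darts G, ~~ intact S d' & x d' = x d]) ->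
  glued S'.
Proof.
move=> sub gS H x xs xf; have xf' d : d \in darts G -> edge_of d \notin S -> x (flip d) = x d.
  by move=> dG dS; apply: xf => //; apply: contra dS => /(subsetP sub).
have P d : d \in darts G -> ~~ intact S' d ->
    exists d', [/\ d' \in darts G, ~~ intact S d' & x d' = x d].
  move=> dG nd; have [iS|nS] := boolP (intact S d); last by exists d.
  by apply: H.
move=> d d' dG d'G /(P _ dG)[a [aG na <-]] /(P _ d'G)[b [bG nb <-]].
exact: gS.
Qed.

Lemma not_intactP S d :
  ~~ intact S d -> exists2 d', d' \in face_at N d & edge_of d' \notin S.
Proof. by rewrite negb_forall => /existsP[d']; rewrite negb_imply => /andP[]; exists d'. Qed.

Lemma notin_intact S d d' :
  d' \in face_at N d -> edge_of d' \notin S -> ~~ intact S d.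
Proof. by move=> d'F; apply: contra => /intactP/(_ _ d'F). Qed.

Lemma rot_cross z (q : pred V) b x : G z b -> G z x -> q b -> ~~ q x ->
  exists w, [/\ G z w, q w & ~~ q (N z w)].
Proof.
move=> Gb Gx; have /iter_findex := rot_next_cyclic N Gb Gx.
move: (findex _ _ _) => n; elim: n b Gb => [|n IH] b Gb; first by move=> /= -> ->.
rewrite iterSr => E qb nx; have [qN|nqN] := boolP (q (N z b)).
  exact: (IH _ (rot_next_adj N Gb) E qN nx).
by exists b.
Qed.

Lemma within_sym S : symmetric (within G S).
Proof. by move=> p q; rewrite /within /= adj_sym edgeC. Qed.

Lemma within_irr S : irreflexive (within G S).
Proof. by move=> p; rewrite /within /= adj_irr. Qed.

Hypothesis hplane : plane N.
Hypothesis hconn : vertex_connected G 2.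

Lemma noncut y a b : a != y -> b != y -> connect (avoid G y) a b.
Proof.
case: hconn => _ /(_ [set y]); rewrite cards1 => /(_ isT) H ay by_.
by have := H a b; rewrite !inE => /(_ ay by_); rewrite (eq_connect (e' := avoid G y)) // => p q /=; rewrite !inE.
Qed.

Lemma all_connected u v : connect G u v.
Proof.
case: hconn => _ /(_ set0); rewrite cards0 => /(_ isT) /(_ u v).
rewrite !inE => /(_ isT isT); apply: connect_sub => p q /=.
by case/andP=> Gpq _; apply: connect1.
Qed.

Lemma rot_neq u v : G u v -> N u v != v.
Proof.
move=> Guv; apply/eqP => Nv; have uv := adj_neq Guv.
have [w wuv] : exists w, w \notin [set u; v].
  apply/existsP; rewrite -negb_forall; apply/negP => /forallP H.
  have [] := hconn; rewrite ltnNge => /negP[].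
  apply: (@leq_trans #|[set u; v]|); last by rewrite cards2; case: (u != v).
  by apply/subset_leq_card/subsetP => w _; apply: H.
move: wuv; rewrite !inE negb_or => /andP[wu wv].
have /connectP[[|p l] /=] := noncut uv wv; first by move=> _ E; rewrite E eqxx in wu.
case/andP=> /and3P[Gup _ pv] _ _.
have /iter_findex := rot_next_cyclic N Guv Gup.
have -> n : iter n (N u) v = v by elim: n => //= n ->.
by move=> E; rewrite E eqxx in pv.
Qed.

Lemma rot_prev_neq u v : G u v -> rot_prev N u v != v.
Proof.
move=> Guv; apply: contraNneq (rot_neq Guv) => E.
by rewrite -{1}E rot_prevK.
Qed.

Lemma head_inj d d' : d \in darts G -> d' \in face_at N d ->
  d.2 = d'.2 -> d = d'.
Proof.
case: d d' => a y [b y'] dG d'F /= E; subst y'; congr pair.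
apply: (face_head_inj hplane all_connected noncut dG _ d'F).
exact: face_at_dart d'F.
Qed.

(** Dropping [m] breaks the two faces along it; as [d] then lies between two
   broken faces and may be peeled too, these faces join the old region
   across [d]. *)
Lemma peel_pair S d m e1 e2 : glued S -> d \in darts G -> edge_of d \in S ->
    intact S d -> ~~ intact S (flip d) -> m \in face_at N d ->
    intact S (flip m) ->
    (forall f, f \in S -> f != edge_of m ->
      facially_adjacent N (edge_of d) f -> f = e1 \/ f = e2) ->
  exists S', [/\ S' \proper S, glued S' & colorable S' -> colorable S].
Proof.
move=> gS dG dS id nfd mF ifm nbr.
have mG := face_at_dart dG mF; have im : intact S m by rewrite (intact_face _ dG).
have dm : edge_of d != edge_of m.
  apply/eqP => /edge_of_eq[]E; first by rewrite E ifm in nfd.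
  by rewrite E flipK im in nfd.
have sub1 := subD1set S (edge_of m).
have sub2 := subD1set (S :\ edge_of m) (edge_of d).
exists (S :\ edge_of m :\ edge_of d); split.
- apply/properP; split; first exact: subset_trans sub2 sub1.
  by exists (edge_of m); [exact: intactW im | rewrite !inE eqxx andbF].
- apply: (glued_shrink _ gS); first exact: subset_trans sub2 sub1.
  move=> x [xs xf] d1 d1G i1 n1; have [d' d'F d'S] := not_intactP n1.
  exists (flip d); rewrite dart_flip; split=> //.
  have xd : x (flip d) = x d by apply: xf; rewrite // !inE eqxx.
  have xm : x (flip m) = x m by apply: xf; rewrite // !inE eqxx andbF.
  rewrite xd -(face_const xs d1G d'F).
  have xmd := face_const xs dG mF.
  have d'S1 : edge_of d' \in S by move/intactP: i1; apply.
  move: d'S; rewrite !inE d'S1 andbT negb_and !negbK.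
  case/orP=> /eqP/edge_of_eq[]->; rewrite ?xd ?xm ?xmd //.
- move=> col; apply: (drop_top mG im ifm).
  apply: (drop_edge dG _ _ _ _ col (e1 := e1) (e2 := e2)).
  + by rewrite in_setD1 dm.
  + by apply: (notin_intact mF); rewrite setD11.
  + by apply: contra nfd; apply: intact_sub.
  + by move=> f; rewrite in_setD1 => /andP[fm fS]; apply: nbr.
Qed.

Lemma peel_face S d : glued S -> d \in darts G -> intact S d ->
    (forall m, m \in face_at N d -> ~~ intact S (flip m)) ->
    (forall a b, (a, b) \in face_at N d ->
       (b != d.1 -> edge_of (b, rot_prev N b a) \in S ->
          edge_of (b, rot_prev N b a) \in boundary (face_at N d)) /\
       (a != d.1 -> edge_of (a, N a b) \in S ->
          edge_of (a, N a b) \in boundary (face_at N d))) ->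
  exists S', [/\ S' \proper S, glued S' & colorable S' -> colorable S].
Proof.
move=> gS dG id nfl outer; pose B := boundary (face_at N d).
have dF := face_at_refl N d; have dB : edge_of d \in B by apply: imset_f.
exists (S :\: B); split.
- apply/properP; split; first exact: subsetDl.
  by exists (edge_of d); rewrite ?(intactW id) // in_setD dB.
- apply: (glued_shrink _ gS); first exact: subsetDl.
  move=> x [xs xf] d1 d1G i1 n1; have [d' d'F d'S] := not_intactP n1.
  exists (flip d); rewrite dart_flip; split=> //; first exact: nfl.
  rewrite (xf d) //; last by rewrite in_setD dB.
  rewrite -(face_const xs d1G d'F).
  have d'S1 : edge_of d' \in S by move/intactP: i1; apply.
  move: d'S; rewrite in_setD d'S1 andbT negbK => d'B.
  case/imsetP: (d'B) => m mF E.
  have mG := face_at_dart dG mF.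
  rewrite -(face_const xs dG mF); case/edge_of_eq: E => -> //.
  by rewrite xf // in_setD -/B (imset_f _ mF).
- move=> col; apply: (drop_face rot_neq head_inj dG id nfl outer col).
Qed.

Lemma corner_intact S y w : G y w -> intact S (y, N y w) = intact S (w, y).
Proof. by move=> Gyw; apply: (@intact_step _ _ N S (w, y)); rewrite dartE adj_sym. Qed.

Lemma prev_corner_intact S y w :
  G y w -> intact S (rot_prev N y w, y) = intact S (y, w).
Proof.
move=> Gyw; rewrite -(corner_intact _ (rot_prev_adj N Gyw)).
by rewrite rot_prevK.
Qed.

Lemma arc_first S y a b : intact_arc N S y a b -> intact S (a, y).
Proof. by case=> i [i0 _ /(_ 0)]; apply. Qed.

Lemma arc_last S y a b : G y a -> intact_arc N S y a b -> intact S (y, b).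
Proof.
move=> Gya [[|i] [// _ <- /(_ i (ltnSn i))]] /=.
rewrite corner_intact //.
by apply: (iter_in (S := G y)) => //; apply: rot_nbr.
Qed.

Lemma arc_second S y a b :
  intact_arc N S y a b -> N y a != b -> intact S (N y a, y).
Proof.
case=> [[|[|i]] [// _ ib ii]]; first by rewrite -ib eqxx.
by move=> _; apply: (ii 1).
Qed.

Lemma arc_penult S y a b : G y a ->
  intact_arc N S y a b -> N y a != b -> intact S (y, rot_prev N y b).
Proof.
move=> Gya [[|[|i]] [// _ ib ii]]; first by rewrite -ib eqxx.
have Git j : G y (iter j (N y) a).
  by apply: (iter_in (S := G y)) => //; apply: rot_nbr.
by move=> _; rewrite -ib /= rot_nextK ?corner_intact ?ii ?rot_next_adj.
Qed.

(** In other words, all broken corners at [w] lie in one gap between consecutive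
   edges of [S]. By [arc_of_cycle] this holds at every vertex that is no cut
   vertex of the graph formed by [S]. *)
Definition clean S w := forall b b', within G S w b -> within G S w b' ->
  b != b' -> intact_arc N S w b b' \/ intact_arc N S w b' b.

(** The edge of [d] can be peeled once a suitable edge [m] of its face has been
   dropped. *)
Definition openable S d := exists m e1 e2,
  [/\ m \in face_at N d, intact S (flip m) &
    forall f, f \in S -> f != edge_of m ->
      facially_adjacent N (edge_of d) f -> f = e1 \/ f = e2].

Lemma openable2 S d e1 e2 :
    (forall f, f \in S -> facially_adjacent N (edge_of d) f -> f = e1 \/ f = e2) ->
  (exists2 m, m \in face_at N d & intact S (flip m)) -> openable S d.
Proof.
by move=> H [m mF im]; exists m, e1, e2; split=> // f fS _; apply: H.
Qed.

(** At [z] one neighbour of the edge is already gone. The neighbour at [w] within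
   the face of [(z, w)] is chosen as [m] when the neighbour at [w] across the edge is in
   [S] and different from it; then a third edge of [S] at [w] exists, and
   cleanness at [w] makes the face behind [m] intact. In the other cases two
   neighbours remain for any choice of [m]. *)
Lemma openable_next S z w : within G S z w -> clean S w ->
    edge_of (z, N z w) \notin S -> ~~ intact S (w, z) ->
    (exists2 m, m \in face_at N (z, w) & intact S (flip m)) ->
  openable S (z, w).
Proof.
case/andP=> Gzw zwS cw zn nwz ex; have Gwz : G w z by rewrite adj_sym.
case: (boolP ((edge_of (w, rot_prev N w z) \in S) &&
              (N w z != rot_prev N w z))) => [/andP[wP NP]|nP]; last first.
  apply: (openable2 (e1 := edge_of (w, N w z)) (e2 := edge_of (z, rot_prev N z w))) ex.
  move=> f fS /(fadj_cases Gzw)[] E; [by left | left | | by right].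
    by move: nP; rewrite -E fS negbK E => /eqP->.
  by rewrite -E fS in zn.
have wzr : within G S w z by rewrite /within /= Gwz edgeC.
have wpr : within G S w (rot_prev N w z) by rewrite /within /= rot_prev_adj.
exists (w, N w z), (edge_of (w, rot_prev N w z)), (edge_of (z, rot_prev N z w)).
split; first exact: (mem_step N (z, w)).
  rewrite /flip /=; case: (cw _ _ wzr wpr) => [|/arc_second|/arc_first].
  - by rewrite eq_sym rot_prev_neq.
  - exact.
  - by rewrite prev_corner_intact // (negPf nwz).
move=> f fS fm /(fadj_cases Gzw)[] E; [| by left | | by right].
  by rewrite E eqxx in fm.
by rewrite -E fS in zn.
Qed.

(** The mirror image of [openable_next]. *)
Lemma openable_prev S z w : within G S z w -> clean S w ->
    edge_of (z, rot_prev N z w) \notin S -> ~~ intact S (z, w) ->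
    (exists2 m, m \in face_at N (w, z) & intact S (flip m)) ->
  openable S (w, z).
Proof.
case/andP=> Gzw zwS cw zn nzw ex; have Gwz : G w z by rewrite adj_sym.
case: (boolP ((edge_of (w, N w z) \in S) &&
              (N w z != rot_prev N w z))) => [/andP[wN NP]|nP]; last first.
  apply: (openable2 (e1 := edge_of (w, rot_prev N w z)) (e2 := edge_of (z, N z w))) ex.
  move=> f fS /(fadj_cases Gwz)[] E; [by right | | left | by left].
    by rewrite -E fS in zn.
  by move: nP; rewrite -E fS negbK E => /eqP->.
have wzr : within G S w z by rewrite /within /= Gwz edgeC.
have wnr : within G S w (N w z) by rewrite /within /= rot_next_adj.
have pwG : (rot_prev N w z, w) \in darts G by rewrite dartE adj_sym rot_prev_adj.
exists (rot_prev N w z, w), (edge_of (w, N w z)), (edge_of (z, N z w)).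
split.
- apply: face_at_sym => //; have := mem_step N (rot_prev N w z, w).
  by rewrite /face_step /= rot_prevK.
- rewrite /flip /=; case: (cw _ _ wzr wnr) => [|/arc_first|arc].
  + by rewrite eq_sym rot_neq.
  + by rewrite (negPf nzw).
  apply: (arc_penult _ arc); first exact: rot_next_adj.
  by apply: contra NP => /eqP E; rewrite -{2}E rot_nextK // rot_next_adj.
move=> f fS fm /(fadj_cases Gwz)[] E; [by right | | by left | ].
  by rewrite -E fS in zn.
by rewrite E edgeC eqxx in fm.
Qed.

(** If the faces next to that of [(a, b)] are broken, the corner at [b] is a
   maximal run of intact corners, so cleanness leaves no room for further edges
   of [S] at [b]. *)
Lemma clean_face S a b c : (a, b) \in darts G -> clean S b ->
    edge_of (a, b) \in S -> within G S b c ->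
    ~~ intact S (b, a) -> ~~ intact S (N b a, b) ->
  c = a \/ c = N b a.
Proof.
rewrite dartE => Gab cb abS rbc nba nNb.
have Gba : G b a by rewrite adj_sym.
have [Gbc _] := andP rbc.
have rba : within G S b a by rewrite /within /= Gba edgeC.
case: (eqVneq c a) => [|ca]; [by left | right].
case: (cb _ _ rbc rba ca) => [/(arc_last Gbc)|arc]; first by rewrite (negPf nba).
case: (eqVneq (N b a) c) => // Nc.
by have := arc_second arc Nc; rewrite (negPf nNb).
Qed.

(** At a vertex with a single edge of [S] both sides of that edge are broken, and
   neighbours remain at the other end only. *)
Lemma peel_leaf S q p : glued S -> within G S q p ->
    (forall w, within G S q w -> w = p) ->
  exists S', [/\ S' \proper S, glued S' & colorable S' -> colorable S].
Proof.
move=> gS /andP[Gqp qpS] only; have Gpq : G p q by rewrite adj_sym.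
have {}only w : G q w -> edge_of (q, w) \in S -> w = p.
  by move=> Gqw qwS; apply: only; apply/andP.
have qpG : (q, p) \in darts G by rewrite dartE.
have pqG : (p, q) \in darts G by rewrite dartE.
have nN : edge_of (q, N q p) \notin S.
  by apply: contra (rot_neq Gqp) => /only ->; rewrite ?rot_next_adj.
have nP : edge_of (q, rot_prev N q p) \notin S.
  by apply: contra (rot_prev_neq Gqp) => /only ->; rewrite ?rot_prev_adj.
have n1 : ~~ intact S (p, q).
  by apply: (notin_intact (mem_step N _)); apply: nN.
have n2 : ~~ intact S (q, p).
  rewrite -prev_corner_intact //; apply: (notin_intact (face_at_refl N _)).
  by rewrite edgeC.
have pqS : edge_of (p, q) \in S by rewrite edgeC.
exists (S :\ edge_of (p, q)); split.
- by apply: properD1.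
- apply: (glued_shrink _ gS); first exact: subD1set.
  by move=> x _ d1 d1G i1; rewrite (intact_setD1 pqG d1G).
- apply: (drop_edge pqG pqS n1 n2 (e1 := edge_of (p, N p q))
           (e2 := edge_of (p, rot_prev N p q))) => f fS adj.
  by case: (fadj_cases Gpq adj) => E; [| |left|right] => //; rewrite -E fS in nN nP.
Qed.

(** A face visits [y] at most once, so the rest of its walk stays inside a set
   [D] that can only be left through [y]. *)
Lemma face_within (D : {set V}) y d0 d : d0 \in darts G ->
    (forall d', d' \in face_at N d0 -> d'.1 = y -> d0.1 = y) ->
    (forall d', d' \in face_at N d0 ->
       (d'.1 \in D -> d'.2 \in D \/ d'.2 = y) /\
       (d'.2 \in D -> d'.1 \in D \/ d'.1 = y)) ->
    d \in face_at N d0 -> d.1 \in D -> d.2 \in D ->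
  forall d', d' \in face_at N d0 -> d'.2 != d0.1 -> d'.2 \in D.
Proof.
move=> d0G d0y closed dF d1D d2D.
set k := order step d0; have k2 : 2 < k := face_size rot_neq d0G.
have itF i : iter i step d0 \in face_at N d0 by rewrite inE fconnect_iter.
have itk : iter k step d0 = d0.
  exact: (iter_order_in (@step_dart _ _ N) (@step_inj _ _ N) d0G).
have hny i : i.+1 < k -> (iter i step d0).2 != y.
  move=> ik; apply/eqP => E.
  have E' : iter i.+1 step d0 = d0.
    apply: (face_tail_inj head_inj d0G (itF _) (face_at_refl N _)).
    by rewrite /= E (d0y (iter i.+1 step d0)).
  by have := findex_iter ik; rewrite E' findex0.
have next i : i.+2 < k ->
    ((iter i step d0).2 \in D) = ((iter i.+1 step d0).2 \in D).
  move=> ik; have [/= fwd bwd] := closed _ (itF i.+1).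
  apply/idP/idP => hD.
    case: (fwd hD) => // E.
    by have := hny i.+1 ik; rewrite /= E eqxx.
  case: (bwd hD) => // E.
  by have := hny i (ltnW ik); rewrite E eqxx.
have same i : i.+1 < k -> ((iter i step d0).2 \in D) = (d0.2 \in D).
  by elim: i => // i IH ik; rewrite -next // IH // ltnW.
have d0D : d0.2 \in D.
  case/(face_dartP N d0): dF d1D d2D => j jk -> d1D d2D.
  have [j1|kj] := ltnP j.+1 k; first by rewrite -(same j).
  case: j jk kj d1D {d2D} => [|j] jk kj d1D; first by have := leq_trans k2 kj.
  by rewrite -(same j).
move=> _ /(face_dartP N d0)[i ik ->]; have [ik1 _|ki] := ltnP i.+1 k.
  by rewrite same.
have ki1 : k = i.+1 by apply/eqP; rewrite eqn_leq ki ik.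
by rewrite -{2}itk ki1 /= eqxx.
Qed.

(** The end block argument. At a vertex [z] of the block [D] that carries a peeled
   edge, the broken corners fill one gap between consecutive edges of [S]; these
   edges lead to [w1] and [w2]. *)
Lemma peel S : glued S -> S \proper edges G -> S != set0 ->
  exists S', [/\ S' \proper S, glued S' & colorable S' -> colorable S].
Proof.
move=> gS /properP[subS [e0 e0G e0S]] nS.
pose r := within G S.
have rG p q : r p q -> G p q by case/andP.
have rS p q : r p q -> edge_of (p, q) \in S by case/andP.
have rC p q : r p q -> r q p.
  by case/andP=> Gpq pqS; apply/andP; rewrite adj_sym edgeC.
have rI p q : G p q -> edge_of (p, q) \in S -> r p q by move=> ? ?; apply/andP.
case: (boolP [exists q, exists p, r q p && [forall w, r q w ==> (w == p)]]).
  case/existsP=> q /existsP[p /andP[rqp /forallP only]].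
  apply: (peel_leaf gS (q := q) (p := p) rqp) => w rqw; apply/eqP.
  by move: (only w); rewrite rqw.
move=> noleaf; have deg2 q p : r q p -> exists2 w, r q w & w != p.
  move=> rqp; move/existsPn/(_ q)/existsPn/(_ p): noleaf.
  by rewrite rqp /= negb_forall => /existsP[w]; rewrite negb_imply => /andP[]; exists w.
have [a0 [b0 r0]] : exists a b, r a b.
  case/set0Pn: nS => e eS; have /edgesP[[a b] dG E] := subsetP subS _ eS.
  by exists a, b; apply: rI; rewrite -?dartE // -E.
have [y [D [[a aD] yD Ddeg Dcl Dcut]]] := end_block (within_sym S) (within_irr S) r0.
have arcs z b b' : z \in D -> r z b -> r z b' -> b != b' ->
    intact_arc N S z b b' \/ intact_arc N S z b' b.
  move=> zD rb rb' bb'; apply: arc_of_cycle => //; first exact: all_connected.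
  - exact: rG.
  - exact: rG.
  - exact: rS.
  - exact: rS.
  - exact: Dcut zD rb rb'.
(* If all edges at the block were in [S], nothing but [y] could separate the
   block from the rest of the graph, so that no edge would be outside [S]. *)
have [z zD [x0 Gzx zxS]] : exists2 z, z \in D &
    exists2 x, G z x & edge_of (z, x) \notin S.
  case: (boolP [exists z in D, exists x, G z x && (edge_of (z, x) \notin S)]).
    by case/exists_inP=> z zD /existsP[x /andP[]]; exists z => //; exists x.
  move/exists_inPn => H.
  have DS z x : z \in D -> G z x -> edge_of (z, x) \in S.
    by move=> /H/existsPn/(_ x) + Gzx; rewrite Gzx negbK.
  have allD w : w != y -> w \in D.
    move=> wy; have ay : a != y by apply: contraNneq yD => <-.
    have /connectP[p] := noncut ay wy.
    elim: p a aD {ay} => [|c p IH] a aD /=; first by move=> _ ->.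
    case/andP=> /and3P[Gac _ cy] pth lst; apply: (IH c) => //.
    by case: (Dcl a c aD) => //; [apply: rI; rewrite ?DS|move=> E; rewrite E eqxx in cy].
  case/negP: e0S; have /edgesP[[u v] uvG ->] := e0G; rewrite dartE in uvG.
  have [uy|uy] := eqVneq u y; last by apply: DS; rewrite ?allD.
  rewrite edgeC; apply: DS; last by rewrite adj_sym.
  by apply: allD; rewrite -uy eq_sym (adj_neq uvG).
have [b rzb] := Ddeg z zD.
have cleanD w : w \in D -> clean S w by move=> wD b' c; apply: arcs.
have [w1 [Gw1 w1S w1n]] := rot_cross (q := fun w => edge_of (z, w) \in S)
  (rG _ _ rzb) Gzx (rS _ _ rzb) zxS.
have zbS : ~~ (edge_of (z, b) \notin S) by rewrite negbK rS.
have [w0 [Gw0 w0S /negbNE w2S]] :=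
  rot_cross (q := fun w => edge_of (z, w) \notin S) Gzx (rG _ _ rzb) zxS zbS.
set w2 := N z w0 in w2S; have Gw2 : G z w2 by apply: rot_next_adj.
have rzw1 : r z w1 by apply: rI.
have rzw2 : r z w2 by apply: rI.
have n1 : ~~ intact S (w1, z).
  by rewrite -corner_intact //; apply: (notin_intact (face_at_refl N _)).
have n2 : ~~ intact S (z, w2).
  rewrite corner_intact //; apply: (notin_intact (face_at_refl N _)).
  by rewrite edgeC.
have i1 : intact S (z, w1).
  have [c rzc cw] := deg2 _ _ rzw1.
  case: (arcs _ _ _ zD rzc rzw1 cw) => [/(arc_last (rG _ _ rzc))//|/arc_first].
  by rewrite (negPf n1).
have i2 : intact S (w2, z).
  have [c rzc cw] := deg2 _ _ rzw2.
  case: (arcs _ _ _ zD rzc rzw2 cw) => [/(arc_last (rG _ _ rzc))|/arc_first//].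
  by rewrite (negPf n2).
(* Since [w1] and [w2] differ, one of them is not [y]. *)
have [d [dG d1D d2D dS [id nfd open]]] : exists d, [/\ d \in darts G, d.1 \in D,
    d.2 \in D, edge_of d \in S & [/\ intact S d, ~~ intact S (flip d) &
    (exists2 m, m \in face_at N d & intact S (flip m)) -> openable S d]].
  have [w1y|w1y] := eqVneq w1 y; last first.
    have w1D : w1 \in D by case: (Dcl z w1 zD rzw1) => // E; rewrite E eqxx in w1y.
    exists (z, w1); rewrite dartE; split=> //; split=> // ex.
    exact: openable_next (cleanD _ w1D) w1n n1 ex.
  have w2D : w2 \in D.
    case: (Dcl z w2 zD rzw2) => // E; move: n2.
    by rewrite E -w1y i1.
  exists (w2, z); rewrite dartE adj_sym edgeC; split=> //; split=> // ex.
  by apply: openable_prev (cleanD _ w2D) _ n2 ex; rewrite // rot_nextK.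
case: (boolP [exists m in face_at N d, intact S (flip m)]) => [|/exists_inPn nm].
  case/exists_inP=> m0 m0F im0.
  have [|m [e1 [e2 [mF im nbr]]]] := open; first by exists m0.
  exact: (peel_pair gS dG dS id nfd mF im nbr).
(* The face of [d] has no intact neighbour: its boundary is the whole block, and
   [d0] starts at [y] if the boundary contains [y], anywhere otherwise. *)
have [d0 [d0F d0y]] : exists d0, d0 \in face_at N d /\
    forall d', d' \in face_at N d -> d'.1 = y -> d0.1 = y.
  case: (boolP [exists d' in face_at N d, d'.1 == y]) => [|/exists_inPn no].
    by case/exists_inP=> d' d'F /eqP E; exists d'.
  exists d; split=> [|d' /no/eqP//]; exact: face_at_refl.
have d0G := face_at_dart dG d0F.
have FE := face_at_eq dG d0F.
have id0 : intact S d0 by rewrite (intact_face _ dG).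
have edgeS d' : d' \in face_at N d0 -> edge_of d' \in S by move/intactP: id0; apply.
have stepr d' : d' \in face_at N d0 -> r d'.1 d'.2.
  by move=> d'F; apply: rI; [have := face_at_dart d0G d'F; rewrite inE|case: d' d'F => ? ? /edgeS].
have headD d' : d' \in face_at N d0 -> d'.2 != d0.1 -> d'.2 \in D.
  have dF0 : d \in face_at N d0 by rewrite FE face_at_refl.
  apply: (face_within d0G _ _ dF0 d1D d2D) => c cF.
    by apply: d0y; rewrite -FE.
  split=> cD; [exact: Dcl cD (stepr _ cF) | exact: Dcl cD (rC _ _ (stepr _ cF))].
have tailD d' : d' \in face_at N d0 -> d'.1 != d0.1 -> d'.1 \in D.
  move=> d'F; have [c cF <-] := face_pred d0G d'F; exact: headD.
have clean_step a' b' c : (a', b') \in face_at N d0 -> b' \in D -> r b' c ->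
    c = a' \/ c = N b' a'.
  move=> abF b'D rc; apply: (clean_face (face_at_dart d0G abF) (cleanD _ b'D) _ rc).
  - exact: edgeS abF.
  - by apply: (nm (a', b')); rewrite -FE.
  - by apply: (nm (step (a', b'))); rewrite -FE face_step_mem.
have inB d' : d' \in face_at N d0 -> edge_of d' \in boundary (face_at N d0).
  by move=> d'F; apply: imset_f.
apply: (peel_face gS d0G id0) => [m|a' b' abF]; first by rewrite FE => /nm.
have abG := face_at_dart d0G abF; have Gab : G a' b' by rewrite -dartE.
have Gba : G b' a' by rewrite adj_sym.
split=> [b'0|a'0] eS.
  have rP : r b' (rot_prev N b' a') by apply: rI; rewrite ?rot_prev_adj.
  case: (clean_step _ _ _ abF (headD _ abF b'0) rP) => ->.
    by rewrite edgeC inB.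
  exact: (inB _ (face_step_mem d0G abF)).
have rN : r a' (N a' b') by apply: rI; rewrite ?rot_next_adj.
have [[c a''] cF] := face_pred d0G abF.
have cG := face_at_dart d0G cF; rewrite /face_step /= => -[E1 E2]; subst a''.
case: (clean_step _ _ _ cF (tailD _ abF a'0) rN) => ->.
  by rewrite edgeC inB.
by rewrite E2 inB.
Qed.

Lemma glued_colorable S : glued S -> S \proper edges G -> colorable S.
Proof.
have [n] := ubnP #|S|; elim: n S => // n IH S; rewrite ltnS => Sn gS SG.
have [->|nS] := eqVneq S set0.
  exists (fun=> 0); split=> [e|e f|d dG /intactW|d dG _]; rewrite ?inE //.
have [S' [S'S gS' col]] := peel gS SG nS; apply/col/IH => //.
  exact: leq_trans (proper_card S'S) Sn.
exact: proper_trans SG.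
Qed.

Lemma edges_colorable : colorable (edges G).
Proof.
have [d dG] : exists d, d \in darts G.
  have [V2 _] := hconn.
  have [u [v uv]] : exists u v : V, u != v.
    have /card_gt1P[u [v [_ _ uv]]] : 1 < #|V| by apply: ltnW.
    by exists u, v.
  have /connectP[[|w p] /=] := all_connected u v.
    by move=> _ E; rewrite E eqxx in uv.
  by case/andP=> Guw _ _; exists (u, w); rewrite dartE.
have iE d' : d' \in darts G -> intact (edges G) d'.
  by move=> d'G; apply/intactP => d1 d1F; apply/mem_edges/(face_at_dart d'G d1F).
have sub := subD1set (edges G) (edge_of d).
apply: (drop_top dG); rewrite ?iE ?dart_flip //.
apply: glued_colorable; last by apply: properD1; apply: mem_edges.
move=> x xs xf.
suff H d1 : d1 \in darts G -> ~~ intact (edges G :\ edge_of d) d1 -> x d1 = x d.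
  by move=> d1 d2 d1G d2G n1 n2; rewrite !H.
move=> d1G /not_intactP[d' d'F]; have d'G := face_at_dart d1G d'F.
rewrite in_setD1 mem_edges // andbT negbK -(face_const xs d1G d'F).
by case/eqP/edge_of_eq=> -> //; rewrite xf // setD11.
Qed.

Lemma chi_fum'_le4 : chi_fum' N <= 4.
Proof.
rewrite /chi_fum'; case: ex_minnP => k _; apply.
have [c [crng cadj ctop _]] := edges_colorable.
apply/existsP; exists [ffun e => inord (c e)].
have cE e : e \in edges G -> ([ffun e => inord (c e)] : {ffun {set V} -> 'I_5}) e = c e :> nat.
  by move=> /crng/andP[_ c4]; rewrite ffunE inordK.
apply/and3P; split.
- by apply/forall_inP => e eG; rewrite cE // crng.
- apply/forall_inP => e eG; apply/forall_inP => f fG; apply/implyP => adj.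
  by rewrite !cE // cadj.
apply/forall_inP => _ /facesP[d dG ->].
have FG d' : d' \in face_at N d -> edge_of d' \in edges G.
  by move=> d'F; apply/mem_edges/(face_at_dart dG d'F).
have [d0 d0F mx] := ctop d dG (introT (intactP _ _ _) FG).
set m := \max_(f in _) _; have mE : m = c (edge_of d0).
  apply/eqP; rewrite eqn_leq; apply/andP; split.
    apply/bigmax_leqP => _ /imsetP[d' d'F ->]; rewrite cE ?FG //.
    by have [->//|/(mx _ d'F)/ltnW] := eqVneq (edge_of d') (edge_of d0).
  rewrite -cE ?FG //.
  apply: (@leq_bigmax_cond _ _ (fun f => ([ffun e => inord (c e)] : {ffun {set V} -> 'I_5}) f : nat)).
  exact: imset_f.
apply/cards1P; exists (edge_of d0); apply/setP => e; rewrite !inE mE.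
apply/andP/eqP => [[/imsetP[d' d'F ->]]|->].
  rewrite cE ?FG //; have [//|/(mx _ d'F)] := eqVneq (edge_of d') (edge_of d0).
  by rewrite ltn_neqAle => /andP[/negPf->].
by rewrite cE ?FG // eqxx; split=> //; apply: imset_f.
Qed.

End Peeling.

Theorem theorem3 (V : finType) (G : sgraph V) (N : rotation G)
    (hplane : plane N) (hconn : vertex_connected G 2) :
  chi_fum' N <= 4.
Proof. exact: chi_fum'_le4. Qed.
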